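(* Let $G=(V,E)$ be a finite connected outerplanar graph with no universal vertex, and with a fixed outerplanar embedding $\Pi$. Then $\mathrm{cc}(G)=2$ if and only if $\Pi$ has at most one internal $k$-face with $k\in\{5,6\}$ and no internal $t$-face with $t>6$.
   Context: All graphs are finite, connected and reflexive (a loop at every vertex; moving along a loop means passing); loops are ignored in embeddings and faces. An internal face of an outerplanar embedding is a bounded face (all vertices lie on the unbounded face); a $k$-face is a face whose boundary has length $k$. A universal vertex is one adjacent to all other vertices. Cops and Attacking Robbers: the cop player places $k$ cops on vertices, then the robber chooses a vertex. In each round the cops move (each cop moves to an adjacent vertex or passes), then the robber moves (to an adjacent vertex or passes). The cops win if after finitely many moves a cop moves onto the robber's vertex. Additionally, if the robber moves onto a vertex occupied by a cop, exactly one cop on that vertex is removed from the game; the robber's initial placement on a cop's vertex does not count as an attack. Both players play optimally. The attacking cop number $\mathrm{cc}(G)$ is the least $k$ such that $k$ cops can guarantee a win. *)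

(* Defs.v *)
From mathcomp Require Import all_boot.
From mathcomp Require Import perm.

Set Implicit Arguments.
Unset Strict Implicit.
Unset Printing Implicit Defensive.

(* Graphs: a finite vertex type T with an adjacency relation e : rel T,
   required (in the theorem) to be symmetric and irreflexive.  The loops of the
   reflexive graph are implicit: moving along a loop = passing. *)

Section Graphs.
Variable T : finType.
Variable e : rel T.

Definition graph_connected := forall x y : T, connect e x y.

Definition universal_vertex (v : T) := forall u : T, u != v -> e v u.

Definition dart (p : T * T) : bool := e p.1 p.2.

Definition rotation_system (s : {perm T * T}) :=
  [/\ forall p, ~~ dart p -> s p = p,
      forall p, dart p -> dart (s p) /\ (s p).1 = p.1 &
      forall p q, dart p -> dart q -> p.1 = q.1 -> fconnect s p q].

Definition face_perm (s : {perm T * T}) (p : T * T) : T * T := s (p.2, p.1).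

Definition face_of (s : {perm T * T}) (p : T * T) : {set T * T} :=
  [set q | fconnect (face_perm s) p q].

Definition faces (s : {perm T * T}) : {set {set T * T}} :=
  [set face_of s p | p in [pred p | dart p]].

(* genus 0 (Euler's formula V - E + F = 2, with E = #darts / 2) *)
Definition planar_rotation (s : {perm T * T}) :=
  2 * #|T| + 2 * #|faces s| = #|[pred p | dart p]| + 4.

(* An outerplanar embedding: a plane embedding (rotation system of genus 0)
   together with a distinguished unbounded (outer) face, given by one of its
   darts, on which every vertex lies. *)
Record outerplanar_embedding := OuterplanarEmbedding {
  rot : {perm T * T};
  outer_dart : T * T;
  rot_system : rotation_system rot;
  rot_planar : planar_rotation rot;
  outer_is_dart : dart outer_dart;
  all_on_outer : forall v : T, exists2 q, q \in face_of rot outer_dart & q.1 = v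
}.

Definition outer_face (P : outerplanar_embedding) : {set T * T} :=
  face_of (rot P) (outer_dart P).

(* internal (bounded) faces; the length of a face is the length of its
   boundary walk, i.e. its number of darts *)
Definition internal_faces (P : outerplanar_embedding) : {set {set T * T}} :=
  [set F in faces (rot P) | F != outer_face P].

Definition cop_step (cs cs' : seq T) : bool :=
  all2 (fun a b => (a == b) || e a b) cs cs'.

(* cops_force cs r : it is the cops' turn, the (alive) cops are at cs
   (a multiset), the robber at r; the cops can force a capture. *)
Inductive cops_force : seq T -> T -> Prop :=
| cf_capture cs r cs' :
    cop_step cs cs' -> r \in cs' -> cops_force cs r
| cf_continue cs r cs' :
    cop_step cs cs' -> r \notin cs' ->
    (forall r', (r' == r) || e r r' ->
       cops_force (if r' \in cs' then rem r' cs' else cs') r') ->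
    cops_force cs r.

(* k cops can guarantee a win: a placement of k cops such that for every
   initial robber vertex (placing on a cop is not an attack) the cops, moving
   first, can force a capture. *)
Definition cops_win (k : nat) : Prop :=
  exists2 cs : seq T, size cs = k & forall r : T, cops_force cs r.

Definition attacking_cop_number_is (n : nat) : Prop :=
  cops_win n /\ forall k, k < n -> ~ cops_win k.

End Graphs.

(* Main.v *)
Require Import Defs.
From mathcomp Require Import all_boot.
From mathcomp Require Import perm.
From mathcomp Require Import all_algebra zify.

(** By Euler's formula every even subgraph Z is the boundary modulo 2 of a set
    of faces, which may be taken not to contain the outer face: this is the
    Jordan curve theorem in the form needed here.  As every vertex lies on the
    outer face, no vertex off Z is enclosed by Z.  Hence an internal face F is
    an induced cycle, each component of G - F is attached to F inside one edge
    of F, two internal faces share at most an edge, and an edge uv together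
    with a component of G - {u,v} attached to both ends spans an internal face
    on the side of that component.

    Two cops can only step next to the robber when they are adjacent (or on the
    same vertex).  On a face of length at least 5 a robber that is not dominated
    at the start then always has a free neighbour on the face.  Two cops cannot
    dominate a face of length at least 7, nor two faces of length at least 5.
    Conversely the cops start on a dominating pair of the only face of length 5
    or 6, move to the edge of it behind which the robber sits, and then push
    him across faces of length 3 and 4 into smaller and smaller components. *)

Set Implicit Arguments.
Unset Strict Implicit.
Unset Printing Implicit Defensive.

(** The Jordan theorem comes from a dimension count over ['F_2]: by Euler's formula the even
    subgraphs form a space of dimension E - V + 1, one less than the number of faces, and the face
    boundaries already fill it. Planarity is then used almost always in the same way: a closed walk
    missing a vertex of an internal face cannot enclose that face, because the missed vertex lies on
    the outer face. So a forbidden configuration is refuted by writing the boundary of the face as a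
    sum of such walks: the sum encloses the face, no summand does. The constants come from induced
    cycles. Two adjacent cops on a cycle of length 4 dominate all of it; from length 5 on they leave
    a neighbour of the robber free. A cop on a long face dominates at most three of its vertices and
    a cop off it at most two, so two cops dominate at most six. What shapes the game is the attack
    rule: a lone cop not yet next to the robber never catches him, so the cops may approach only in
    mutual protection or along vertices that the robber cannot reach. *)

Definition rev_dart (T : Type) (p : T * T) : T * T := (p.2, p.1).

Lemma rev_dartK (T : Type) : involutive (@rev_dart T).
Proof. by case. Qed.

(** * Even subgraphs of a plane map *)

Section EvenSubgraphs.
Import GRing.Theory.
Local Open Scope ring_scope.

Variables (T : finType) (e : rel T).
Hypotheses (e_sym : symmetric e) (e_irr : irreflexive e).
Hypothesis G_conn : graph_connected e.
Variable s : {perm T * T}.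
Hypothesis s_rot : rotation_system e s.

Let phi := face_perm s.
Let nF := #|faces e s|.
Let Edges := [set p : T * T | e p.1 p.2 & (enum_rank p.1 < enum_rank p.2)%N].
Let nE := #|Edges|.
Let nV := #|T|.

Lemma dart_rev p : dart e (rev_dart p) = dart e p.
Proof. by rewrite /dart /= e_sym. Qed.

Lemma face_perm_inj : injective phi.
Proof. by move=> [a b] [c d] /perm_inj [-> ->]. Qed.

Lemma dart_face_perm p : dart e p -> dart e (phi p).
Proof.
case: s_rot => _ h _ dp; case: (h (rev_dart p)) => //.
by rewrite dart_rev.
Qed.

Lemma face_of_eq p q : q \in face_of s p -> face_of s q = face_of s p.
Proof.
rewrite inE => pq; apply/setP => r; rewrite !inE.
by rewrite -(same_connect (fconnect_sym face_perm_inj) pq).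
Qed.

Lemma mem_face_of p : p \in face_of s p.
Proof. by rewrite inE connect0. Qed.

Lemma mem_face F p : F \in faces e s -> (p \in F) = (face_of s p == F).
Proof.
case/imsetP => q _ ->; apply/idP/eqP => [/face_of_eq //|<-]; exact: mem_face_of.
Qed.

Lemma face_perm_mem F p : F \in faces e s -> (phi p \in F) = (p \in F).
Proof.
move=> hF; rewrite !(mem_face _ hF); congr (_ == _); apply: face_of_eq.
by rewrite inE fconnect1.
Qed.

Lemma card_darts : (#|[pred p | dart e p]| = nE.*2)%N.
Proof.
pose Edges' := [set p : T * T | e p.1 p.2 & (enum_rank p.2 < enum_rank p.1)%N].
have E' : #|Edges'| = nE.
  rewrite /nE -(card_imset _ (can_inj (@rev_dartK T))); apply: eq_card => p.
  rewrite -{1}(rev_dartK p) mem_imset; last exact: can_inj (@rev_dartK T).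
  by rewrite !inE /= e_sym.
rewrite -addnn -{2}E' -cardsUI.
have -> : Edges :&: Edges' = set0.
  apply/setP => p; rewrite !inE; apply/negP => /andP[/andP[_ h1] /andP[_ h2]].
  by have := ltn_trans h1 h2; rewrite ltnn.
rewrite cards0 addn0; apply: eq_card => -[x y]; rewrite !inE /dart /=.
case exy: (e x y) => //=; case: ltngtP => // /val_inj /enum_rank_inj xy.
by rewrite xy e_irr in exy.
Qed.

Lemma F2_add_self (x : 'F_2) : x + x = 0.
Proof. by case: x => -[|[|//]] h; apply/val_inj. Qed.

Lemma F2_eq (x y : 'F_2) : x + y = 0 -> x = y.
Proof. by move=> h; rewrite -[RHS]add0r -h -addrA F2_add_self addr0. Qed.

Let Fv (i : 'I_nF) : {set T * T} := enum_val i.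
Let Ev (j : 'I_nE) : T * T := enum_val j.
Let Vv (v : 'I_nV) : T := enum_val v.

(** The boundary maps from faces to edges and, for [B], from edges to vertices. Each edge is
    represented by one dart; an edge with the same face on both sides gets the coefficient 1 + 1 =
    0. *)
Let A : 'M['F_2]_(nF, nE) :=
  \matrix_(i, j) ((Ev j \in Fv i)%:R + (rev_dart (Ev j) \in Fv i)%:R).
Let B : 'M['F_2]_(nE, nV) :=
  \matrix_(j, v) ((Vv v == (Ev j).1)%:R + (Vv v == (Ev j).2)%:R).

Lemma sum_edges_at (h : T * T -> 'F_2) (v : T) :
  (forall p, h (rev_dart p) = h p) ->
  \sum_(j < nE) h (Ev j) * ((v == (Ev j).1)%:R + (v == (Ev j).2)%:R)
  = \sum_(w | e v w) h (v, w).
Proof.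
move=> hs.
rewrite -(big_enum_val (fun p : T * T => h p * ((v == p.1)%:R + (v == p.2)%:R))).
transitivity (\sum_(x : T) \sum_(y : T | (x, y) \in Edges)
   h (x, y) * ((v == x)%:R + (v == y)%:R)).
  by rewrite pair_big_dep; apply: eq_big => -[].
under eq_bigr do rewrite (eq_bigr _ (fun _ _ => mulrDr _ _ _)) big_split.
rewrite big_split /=.
have -> : \sum_(i : T) \sum_(i0 | (i, i0) \in Edges) h (i, i0) * (v == i)%:R
    = \sum_(y | (v, y) \in Edges) h (v, y).
  rewrite (bigD1 v) //= [X in _ + X]big1 ?addr0 => [|x /negPf xv].
    by apply: eq_bigr => y _; rewrite eqxx mulr1.
  by apply: big1 => y _; rewrite eq_sym xv mulr0.
have -> : \sum_(i : T) \sum_(i0 | (i, i0) \in Edges) h (i, i0) * (v == i0)%:R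
    = \sum_(x | (x, v) \in Edges) h (v, x).
  rewrite [RHS]big_mkcond; apply: eq_bigr => x _.
  have [xv|xv] := boolP (_ \in _).
    rewrite (bigD1 v) //= eqxx mulr1 big1 ?addr0 -?[h (v, x)]hs //.
    by move=> y /andP[_ /negPf yv]; rewrite eq_sym yv mulr0.
  rewrite big1 // => y xy; case: eqP => [vy|_]; last by rewrite mulr0.
  by rewrite vy xy in xv.
rewrite (bigID (fun w => (enum_rank v < enum_rank w)%N) (e v)) /=.
congr (_ + _).
  by apply: eq_bigl => w; rewrite !inE.
apply: eq_bigl => w; rewrite !inE /= e_sym -leqNgt.
case vw: (e v w) => //=; case: ltngtP => // /val_inj/enum_rank_inj wv.
by rewrite wv e_irr in vw.
Qed.

(** At a vertex, the darts of a face that arrive and those that leave are equally many: the rotation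
    [s] sends the reverse of an arriving dart to the leaving dart that follows it on the face. *)
Lemma mulAB : A *m B = 0.
Proof.
apply/matrixP => i v; rewrite !mxE.
under eq_bigr do rewrite !mxE.
have iF : Fv i \in faces e s by apply: enum_valP.
rewrite (@sum_edges_at (fun p => (p \in Fv i)%:R + (rev_dart p \in Fv i)%:R)); last first.
  by move=> p; rewrite rev_dartK addrC.
rewrite big_split /=.
have [_ sd sconn] := s_rot.
suff -> : \sum_(w | e (Vv v) w) (rev_dart (Vv v, w) \in Fv i)%:R
   = \sum_(w | e (Vv v) w) ((Vv v, w) \in Fv i)%:R :> 'F_2 by rewrite F2_add_self.
have toP (g : T * T -> 'F_2) : \sum_(w | e (Vv v) w) g (Vv v, w)
   = \sum_(p | dart e p && (p.1 == Vv v)) g p.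
  transitivity (\sum_(x | x == Vv v) \sum_(w | e x w) g (x, w)).
    by rewrite big_pred1_eq.
  by rewrite pair_big_dep; apply: eq_big => -[x y] //=; rewrite andbC.
rewrite (toP (fun p => (rev_dart p \in Fv i)%:R)) (toP (fun p => (p \in Fv i)%:R)).
rewrite [RHS](reindex_inj (@perm_inj _ s)) /=.
have sE p : dart e p -> (s p).1 = p.1 by case/sd.
apply: eq_big => p; last first.
  by move=> _; rewrite -(face_perm_mem _ iF) /phi /face_perm /=; case: p.
have [dp|/negPf ndp] := boolP (dart e p).
  by rewrite (sE _ dp) (sd _ dp).1.
have [sdp _ _] := s_rot; rewrite sdp ?ndp //.
Qed.

Lemma sub_const n (M : 'M['F_2]_(n, n)) :
  (forall u : 'rV_n, (u <= M)%MS -> forall i j, u 0 i = u 0 j) -> (\rank M <= 1)%N.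
Proof.
move=> h; apply: leq_trans (rank_leq_row (const_mx 1 : 'rV_n)).
apply: mxrankS; apply/rV_subP => u /h {}h; apply/sub_rVP.
case: n M u h => [|n] M u h.
  by exists 0; apply/rowP => -[].
by exists (u 0 0); apply/rowP => i; rewrite !mxE mulr1; apply: h.
Qed.

(** As [s] is reversal followed by [phi], [g] is constant around each vertex; reversal carries the
    value across edges, and the graph is connected. *)
Lemma potential_const (g : T * T -> 'F_2) :
  (forall p, dart e p -> g (phi p) = g p) ->
  (forall p, dart e p -> g (rev_dart p) = g p) ->
  forall p q, dart e p -> dart e q -> g p = g q.
Proof.
move=> gphi grev.
have [_ sd sconn] := s_rot.
have gs p : dart e p -> g (s p) = g p.
  move=> dp; rewrite -(grev p) // -(gphi (rev_dart p)) ?dart_rev //.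
  by rewrite /phi /face_perm /=; case: p {dp}.
have gv p q : dart e p -> dart e q -> p.1 = q.1 -> g p = g q.
  move=> dp dq /(sconn _ _ dp dq) /iter_findex <-.
  suff /(_ (findex s p q)) [] : forall n, dart e (iter n s p) /\ g (iter n s p) = g p by [].
  elim=> [|n [d1 IH]] //=; split; first by case: (sd _ d1).
  by rewrite gs.
move=> p q dp dq; have /connectP[l] := G_conn p.1 q.1.
elim: l p dp => [|y l IH] p dp /=; first by move=> _ /esym; apply: gv.
case/andP => py lP lq; rewrite (gv p (p.1, y)) // -(grev (p.1, y)) //.
by apply: IH => //; rewrite /dart /= e_sym.
Qed.

(** A vector in the left kernel colours the faces so that both sides of every edge agree, hence is
    constant; the kernel has dimension at most 1. *)
Lemma rankA : (nF <= \rank A + 1)%N.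
Proof.
rewrite -leq_subLR -mxrank_ker; apply: sub_const => u /sub_kermxP uA.
pose g (p : T * T) : 'F_2 := \sum_i u 0 i * (p \in Fv i)%:R.
have grev p : dart e p -> g (rev_dart p) = g p.
  move=> dp.
  wlog pE : p dp / p \in Edges.
    move=> W; case: (ltngtP (enum_rank p.1) (enum_rank p.2)) => h.
    - by apply: W => //; rewrite inE h andbT.
    - by have := W (rev_dart p); rewrite rev_dartK => <- //;
      rewrite ?dart_rev // inE h andbT /= e_sym.
    by move: dp; rewrite /dart; move/val_inj/enum_rank_inj: h => ->; rewrite e_irr.
  have /rowP/(_ (enum_rank_in pE p)) := uA; rewrite !mxE.
  under eq_bigr do rewrite mxE /Ev enum_rankK_in // mulrDr.
  by rewrite big_split /= => /F2_eq.
have gphi p : dart e p -> g (phi p) = g p.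
  by move=> dp; apply: eq_bigr => i _; rewrite face_perm_mem //; apply: enum_valP.
have gE i p : p \in Fv i -> g p = u 0 i.
  move=> pi; rewrite /g (bigD1 i) //= pi mulr1 big1 ?addr0 // => j ji.
  case: (boolP (p \in Fv j)) => [pj|_]; last by rewrite mulr0.
  case/eqP: ji; apply: enum_val_inj.
  have iF : Fv i \in faces e s by apply: enum_valP.
  have jF : Fv j \in faces e s by apply: enum_valP.
  by move: pi pj; rewrite (mem_face _ iF) (mem_face _ jF) => /eqP h1 /eqP h2;
    rewrite -[LHS]h2.
have ex i : exists2 p, dart e p & p \in Fv i.
  have /imsetP[p dp Fp] : Fv i \in faces e s by apply: enum_valP.
  by exists p => //; rewrite Fp mem_face_of.
move=> i j; case: (ex i) (ex j) => p dp pi [q dq qj].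
by rewrite -(gE _ _ pi) -(gE _ _ qj); apply: potential_const.
Qed.

Lemma rankB : (nV <= \rank B + 1)%N.
Proof.
rewrite -leq_subLR -mxrank_tr -mxrank_ker; apply: sub_const => u /sub_kermxP uB.
have st x y : e x y -> u 0 (enum_rank x) = u 0 (enum_rank y).
  move=> exy.
  wlog xyE : x y exy / (x, y) \in Edges.
    move=> W; case: (ltngtP (enum_rank x) (enum_rank y)) => h.
    - by apply: W => //; rewrite inE h andbT.
    - by apply/esym/W; rewrite 1?inE /= 1?h 1?e_sym 1?exy.
    by rewrite (val_inj h).
  have /rowP/(_ (enum_rank_in xyE (x, y))) := uB; rewrite !mxE.
  under eq_bigr do rewrite !mxE /Ev enum_rankK_in //= mulrDr.
  rewrite big_split /= => /F2_eq.
  have sel z : \sum_(i < #|T|) u 0 i * (Vv i == z)%:R = u 0 (enum_rank z).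
    rewrite (bigD1 (enum_rank z)) //= /Vv enum_rankK eqxx mulr1 big1 ?addr0 // => i iz.
    case: eqP => [vz|_]; last by rewrite mulr0.
    by rewrite -vz enum_valK eqxx in iz.
  by rewrite !sel.
move=> i j; rewrite -(enum_valK i) -(enum_valK j).
have /connectP[l] := G_conn (Vv i) (Vv j).
rewrite -/(Vv i) -/(Vv j); move: (Vv i) => x.
elim: l x => [|y l IH] x /=; first by move=> _ ->.
by case/andP => /st -> lP lj; apply: IH.
Qed.

(* Euler's formula makes the sequence faces -> edges -> vertices of mod 2
   chain groups exact in the middle: both ranks are known. *)
Lemma even_subgraph_potential (Z : T * T -> bool) :
  planar_rotation e s ->
  (forall p, Z (rev_dart p) = Z p) ->
  (forall v, \big[addb/false]_(w | e v w) Z (v, w) = false) ->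
  exists f : T * T -> bool, forall p, dart e p ->
    f (phi p) = f p /\ f p (+) f (rev_dart p) = Z p.
Proof.
move=> euler Zs Zeven.
have b2 (b c : bool) : (b (+) c)%:R = b%:R + c%:R :> 'F_2.
  by case: b c => -[] //=; rewrite ?addr0 ?add0r // F2_add_self.
pose z : 'rV['F_2]_nE := \row_j (Z (Ev j))%:R.
have zB : z *m B = 0.
  apply/rowP => v; rewrite !mxE; under eq_bigr do rewrite !mxE.
  rewrite (@sum_edges_at (fun p => (Z p)%:R)) => [|p]; last by rewrite Zs.
  rewrite -[RHS]/((false : bool)%:R) -(Zeven (Vv v)).
  by rewrite (big_morph (fun b : bool => b%:R : 'F_2) b2 (erefl : false%:R = 0)).
have AB : (A <= kermx B)%MS by apply/sub_kermxP/mulAB.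
(* Here Euler's formula enters: the kernel has dimension at most E - V + 1, which equals the number
   of faces minus 1 and so is at most the rank of [A]. *)
have : (kermx B <= A)%MS.
  rewrite -(geq_leqif (mxrank_leqif_sup AB)) mxrank_ker.
  have := rankA; have := rankB; have := euler; rewrite /planar_rotation card_darts.
  rewrite -/nF -/nV; move: (\rank A) (\rank B) => a b; lia.
move/sub_kermxP: zB => /submx_trans zA /zA /submxP[g zg].
pose f (p : T * T) : 'F_2 := \sum_i g 0 i * (p \in Fv i)%:R.
have F2b (x y : 'F_2) (b : bool) : x + y = b%:R -> (x != 0) (+) (y != 0) = b.
  by case: x y b => -[|[|//]] h1 [[|[|//]] h2] [].
exists (fun p => f p != 0) => p dp; split.
  congr (_ != _); apply: eq_bigr => i _; rewrite face_perm_mem //; apply: enum_valP.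
wlog pE : p dp / p \in Edges.
  move=> W; case: (ltngtP (enum_rank p.1) (enum_rank p.2)) => h.
  - by apply: W => //; rewrite inE h andbT.
  - have := W (rev_dart p); rewrite rev_dartK Zs addbC; apply; first by rewrite dart_rev.
    by rewrite inE h andbT /= e_sym.
  by move: dp; rewrite /dart; move/val_inj/enum_rank_inj: h => ->; rewrite e_irr.
apply: F2b; move/rowP/(_ (enum_rank_in pE p)): zg; rewrite !mxE.
under eq_bigr do rewrite mxE /Ev enum_rankK_in // mulrDr.
by rewrite big_split /= /Ev enum_rankK_in // => <-.
Qed.

End EvenSubgraphs.

(** * Walks and chains modulo 2 *)

Section Walks.
Variables (T : finType) (e : rel T).

(** The modulo 2 chain of a walk: an edge counts by the parity of its traversals in either
    direction, so walks need not be simple and retraced edges cancel. *)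
Fixpoint walk_parity (x : T) (p : seq T) (d : T * T) : bool :=
  if p is y :: p' then (d == (x, y)) (+) (d == (y, x)) (+) walk_parity y p' d
  else false.

Lemma walk_parity_rev x p d : walk_parity x p (rev_dart d) = walk_parity x p d.
Proof.
elim: p x => //= y p IH x; rewrite IH; case: d {IH} => a b.
rewrite /rev_dart /= !xpair_eqE [(b == x) && _]andbC [(b == y) && _]andbC.
by rewrite [(_ && _) (+) (_ && _)]addbC.
Qed.

Lemma walk_parity_cat x p q d :
  walk_parity x (p ++ q) d = walk_parity x p d (+) walk_parity (last x p) q d.
Proof. by elim: p x => //= y p IH x; rewrite IH addbA. Qed.

Lemma walk_parity_off x p v w : v \notin x :: p -> walk_parity x p (v, w) = false.
Proof.
elim: p x => //= y p IH x; rewrite inE negb_or => /andP[vx vyp].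
rewrite IH //; move: vyp; rewrite inE negb_or => /andP[vy _].
by rewrite !xpair_eqE (negPf vx) (negPf vy).
Qed.

Lemma walk_parity_boundary x p v :
  \big[addb/false]_w walk_parity x p (v, w) = (v == x) (+) (v == last x p).
Proof.
have one (a b : T) : \big[addb/false]_w ((v, w) == (a, b)) = (v == a).
  rewrite (bigD1 b) //= xpair_eqE eqxx andbT big1 ?addbF // => w /negPf wb.
  by rewrite xpair_eqE wb andbF.
elim: p x => [|y p IH] x /=; first by rewrite big1 ?addbb.
by rewrite !big_split /= !one IH !addbA addbK.
Qed.

Lemma walk_parity_dart x p d :
  symmetric e -> path e x p -> walk_parity x p d -> dart e d.
Proof.
move=> e_sym; elim: p x => //= y p IH x /andP[xy yp].
case wp: (walk_parity y p d); first by rewrite (IH y).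
rewrite addbF; case: eqP => [-> //|_]; case: eqP => [-> _|//].
by rewrite /dart /= e_sym.
Qed.

(** Its connectivity classes outside [S] are the components of G - S. A vertex of [S] is connected
    only to itself, whence the recurring side condition that the start is not in [S]. *)
Definition avoid (S : {set T}) : rel T :=
  [rel x y | [&& e x y, x \notin S & y \notin S]].

Lemma avoid_sym S : symmetric e -> symmetric (avoid S).
Proof. by move=> e_sym x y; rewrite /avoid /= e_sym [(x \notin S) && _]andbC. Qed.

Lemma avoid_connect_sym S : symmetric e -> connect_sym (avoid S).
Proof. by move=> e_sym; apply/sym_connect_sym/avoid_sym. Qed.

Lemma avoid_path (S : {set T}) x p : x \notin S ->
  path (avoid S) x p -> path e x p /\ {in x :: p, forall y, y \notin S}.
Proof.
elim: p x => [|y p IH] x xS /=; first by split => // y; rewrite inE => /eqP ->.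
case/andP => /and3P[exy _ yS] /(IH _ yS)[pP pS]; split; first by rewrite exy.
by move=> z; rewrite inE => /predU1P[->|/pS].
Qed.

Lemma avoid_connect (S : {set T}) x y : x \notin S -> connect (avoid S) x y ->
  exists p, [/\ path e x p, y = last x p, {in x :: p, forall z, z \notin S} &
    {in x :: p, forall z, connect (avoid S) x z}].
Proof.
move=> xS /connectP[p pP ->]; exists p; have [p1 p2] := avoid_path xS pP.
split => // z; rewrite inE => /predU1P[->|zp]; first exact: connect0.
by case/splitPr: zp pP => q1 q2; rewrite cat_path /= => /and3P[h1 h2 _];
  apply: connect_trans (connect1 h2); apply/connectP; exists q1.
Qed.

Lemma connect_avoid_notin (S : {set T}) x y :
  x \notin S -> connect (avoid S) x y -> y \notin S.
Proof. by move=> xS /(avoid_connect xS)[p [_ -> h _]]; apply/h/mem_last. Qed.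

End Walks.

(** * Enclosure of faces by even subgraphs *)

Section Embedding.
Variables (T : finType) (e : rel T).
Hypotheses (e_sym : symmetric e) (e_irr : irreflexive e).
Hypothesis G_conn : graph_connected e.
Variable P : outerplanar_embedding e.

Let s := Defs.rot P.
Let phi := face_perm s.
Let outer := outer_face P.
Let s_rot : rotation_system e s := rot_system P.

(* [f] tells for each dart whether the face on its side is enclosed by the even
   subgraph [Z], the outer face being outside. *)
Definition potential (Z f : T * T -> bool) :=
  [/\ forall d, dart e d -> f (phi d) = f d,
      forall d, dart e d -> f d (+) f (rev_dart d) = Z d &
      forall d, d \in outer -> f d = false].

Definition chain (Z : T * T -> bool) :=
  (forall d, Z (rev_dart d) = Z d) /\ (forall d, Z d -> dart e d).

Definition boundary (Z : T * T -> bool) (v : T) := \big[addb/false]_w Z (v, w).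

Definition add_chain (Z1 Z2 : T * T -> bool) d := Z1 d (+) Z2 d.

Lemma chain_walk x p : path e x p -> chain (walk_parity x p).
Proof.
move=> xp; split => d; first exact: walk_parity_rev.
exact: walk_parity_dart.
Qed.

Lemma chain_add Z1 Z2 : chain Z1 -> chain Z2 -> chain (add_chain Z1 Z2).
Proof.
move=> [s1 d1] [s2 d2]; split => d; rewrite /add_chain ?s1 ?s2 //.
by case h1: (Z1 d); [move=> _; apply: d1|move/d2].
Qed.

Lemma boundary_add Z1 Z2 v :
  boundary (add_chain Z1 Z2) v = boundary Z1 v (+) boundary Z2 v.
Proof. exact: big_split. Qed.

Lemma iter_face_perm_dart d n : dart e d -> dart e (iter n phi d).
Proof. by move=> dd; elim: n => //= n; apply: dart_face_perm. Qed.

Lemma face_invariant (f : T * T -> bool) d d' :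
  (forall d, dart e d -> f (phi d) = f d) ->
  dart e d -> fconnect phi d d' -> f d' = f d.
Proof.
move=> fphi dd /iter_findex <-; elim: (findex _ _ _) => //= n <-.
by apply: fphi; apply: iter_face_perm_dart.
Qed.

(** A potential may be shifted by a constant; adding its value on the outer face makes it vanish
    there. *)
Lemma cycle_potential Z :
  chain Z -> (forall v, boundary Z v = false) -> exists f, potential Z f.
Proof.
move=> [Zs Zd] Z0.
have [|f fP] := even_subgraph_potential e_sym e_irr G_conn s_rot (rot_planar P) Zs.
  move=> v; rewrite -[RHS](Z0 v) big_mkcond; apply: eq_bigr => w _.
  by case: ifP => // /negbT vw; apply/esym/negbTE; apply: contra vw => /Zd.
exists (fun d => f d (+) f (outer_dart P)); split => d.
- by move/fP => [->].
- by move/fP => [_ <-]; rewrite addbACA addbb addbF.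
rewrite inE => h; rewrite (face_invariant _ _ h) ?addbb //; last exact: outer_is_dart.
by move=> d' /fP[].
Qed.

Lemma potential_ext Z Z' f : (forall d, Z d = Z' d) -> potential Z f -> potential Z' f.
Proof. by move=> ZZ [a b c]; split => // d dd; rewrite -ZZ b. Qed.

Lemma potential_add Z1 Z2 f1 f2 : potential Z1 f1 -> potential Z2 f2 ->
  potential (add_chain Z1 Z2) (add_chain f1 f2).
Proof.
move=> [a1 b1 c1] [a2 b2 c2]; split => d hd; rewrite /add_chain.
- by rewrite a1 ?a2.
- by rewrite addbACA b1 ?b2.
by rewrite c1 ?c2.
Qed.

Lemma outer_dart_at v : exists d, [/\ d \in outer, dart e d & d.1 = v].
Proof.
have [d dO dv] := all_on_outer P v; exists d; split => //.
move: dO; rewrite inE => /iter_findex <-.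
exact/iter_face_perm_dart/outer_is_dart.
Qed.

(** Turning from [d] to [s d] crosses the edge of [d]: the dart [s d] lies on the same face as the
    reverse of [d]. *)
Lemma potential_rot Z f d : potential Z f -> dart e d -> f (s d) = f d (+) Z d.
Proof.
case=> fphi fZ _ dd; rewrite -(fZ _ dd) addKb.
by rewrite -(fphi (rev_dart d)) ?dart_rev // /phi /face_perm /=; case: (d).
Qed.

(* The vertex [v] lies on the outer face, hence is not enclosed. *)
Lemma potential_off Z f v : potential Z f -> (forall w, Z (v, w) = false) ->
  forall d, dart e d -> d.1 = v -> f d = false.
Proof.
move=> pf Zv d dd dv; have [q [qO dq qv]] := outer_dart_at v.
have [_ sd sc] := s_rot.
have /iter_findex <- : fconnect s q d by apply: sc; rewrite ?qv ?dv.
suff [] : let d' := iter (findex s q d) s q in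
  [/\ dart e d', d'.1 = v & f d' = false] by [].
elim: (findex _ _ _) => [|n [d1 v1 f1]] /=.
  by case: pf => _ _ ->.
have [d2 v2] := sd _ d1; split; rewrite ?v2 //.
by rewrite (potential_rot pf d1) f1 [iter _ _ _]surjective_pairing v1 Zv.
Qed.

(** The sum of the two is a potential of the zero chain, and no vertex lies on that chain. *)
Lemma potential_eq Z Z' f f' : potential Z f -> potential Z' f' ->
  (forall d, Z d = Z' d) -> forall d, dart e d -> f d = f' d.
Proof.
move=> pf pf' ZZ d dd; apply/eqP; rewrite -negb_add; apply/negbT.
apply: (potential_off (potential_add pf pf') _ dd erefl) => w.
by rewrite /add_chain ZZ addbb.
Qed.

(** Rotating around [v] from [s k1], the value can change only when [k1] or [k2] is crossed.
    Crossing [k1] leads back to the start, so the value is still the initial one when [k2] is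
    reached. *)
Lemma potential_toggle Z f v k1 k2 : potential Z f ->
  dart e k1 -> dart e k2 -> k1.1 = v -> k2.1 = v ->
  (forall d, dart e d -> d.1 = v -> d != k1 -> d != k2 -> Z d = false) ->
  f (s k1) = f k2.
Proof.
move=> pf d1 d2 v1 v2 Zv; have [_ sd sc] := s_rot.
apply/eqP; apply/negPn/negP => ne.
have [d3 v3] := sd _ d1; rewrite v1 in v3.
suff: forall n, let d := iter n s (s k1) in
    [/\ dart e d, d.1 = v & f d = f (s k1)].
  have /iter_findex it : fconnect s (s k1) k2 by apply: sc; rewrite ?v3 ?v2.
  by move/(_ (findex s (s k1) k2)); rewrite it => -[_ _ h]; rewrite h eqxx in ne.
elim=> [|n] //=; set d := iter n s (s k1) => -[dd dv fd].
have [d4 v4] := sd _ dd; split; rewrite ?v4 //.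
have [->//|dk1] := eqVneq d k1.
rewrite (potential_rot pf dd) Zv ?addbF //.
by apply: contra ne => /eqP <-; rewrite fd.
Qed.

(** A path from [a] to [b] in G - v is closed up through [v]. The cycle stays in [v] and one
    component of G - v. *)
Lemma cycle_through_vertex v a b : e v a -> e v b ->
  connect (avoid e [set v]) a b ->
  exists Z f, [/\ potential Z f, forall w, Z (v, w) = (w == a) (+) (w == b) &
    forall u w, u != v -> ~~ connect (avoid e [set v]) a u -> Z (u, w) = false].
Proof.
move=> va vb; have av : a \notin [set v] by rewrite inE; apply: contraL va => /eqP ->;
  rewrite e_irr.
move=> /(avoid_connect av)[p [pP pb pv pc]].
have wP : path e v (rcons (a :: p) v) by rewrite rcons_path /= va pP -pb e_sym.
have [|f pf] := cycle_potential (chain_walk wP).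
  by move=> u; rewrite /boundary walk_parity_boundary last_rcons addbb.
exists (walk_parity v (rcons (a :: p) v)), f; split => //.
  move=> w; rewrite /= -cats1 walk_parity_cat -pb /= addbF.
  rewrite walk_parity_off; last by apply/negP => /pv; rewrite inE eqxx.
  have nv x : x \in a :: p -> (v == x) = false.
    by move=> /pv; rewrite inE eq_sym => /negPf.
  have bp : b \in a :: p by rewrite pb mem_last.
  by rewrite !xpair_eqE eqxx !nv ?mem_head //= addbF.
move=> u w uv ac; apply: walk_parity_off.
rewrite inE mem_rcons inE !(negPf uv) /=.
by apply/negP => /pc h; rewrite h in ac.
Qed.

Lemma face_connect (F : {set T * T}) d d' : F \in faces e s -> d \in F -> d' \in F ->
  fconnect phi d d'.
Proof. by move=> hF; rewrite (mem_face _ hF) => /eqP <-; rewrite inE. Qed.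

Lemma face_dart (F : {set T * T}) d : F \in faces e s -> d \in F -> dart e d.
Proof.
case/imsetP => p dp ->; rewrite inE => /iter_findex <-.
exact: iter_face_perm_dart.
Qed.

Lemma potential_face (F : {set T * T}) Z f d d' : F \in faces e s -> potential Z f ->
  d \in F -> d' \in F -> f d = f d'.
Proof.
move=> hF [fphi _ _] dF d'F.
exact: face_invariant (face_dart hF d'F) (face_connect hF d'F dF).
Qed.

Lemma outer_faces : outer \in faces e s.
Proof. by apply: imset_f; apply: outer_is_dart. Qed.

Lemma internal_face (F : {set T * T}) : F \in internal_faces P -> F \in faces e s.
Proof. by rewrite inE => /andP[]. Qed.

Lemma internal_face_outer (F : {set T * T}) d : F \in internal_faces P -> d \in F ->
  d \notin outer.
Proof.
rewrite inE => /andP[hF FO]; rewrite (mem_face _ hF) (mem_face _ outer_faces).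
by move=> /eqP ->.
Qed.

Definition face_edges (F : {set T * T}) (d : T * T) := (d \in F) (+) (rev_dart d \in F).

Lemma face_potential (F : {set T * T}) : F \in internal_faces P ->
  potential (face_edges F) (fun d => d \in F).
Proof.
move=> hF; split => // d; first by rewrite (face_perm_mem _ (internal_face hF)).
by move=> dO; apply: contraTF dO; apply: internal_face_outer.
Qed.

Lemma orbit_exit (X : pred (T * T)) d d' : fconnect phi d d' -> X d -> ~~ X d' ->
  exists q, [/\ fconnect phi d q, X q & ~~ X (phi q)].
Proof.
move=> /iter_findex <-; elim: (findex _ _ _) => [|n IH] /= Xd; first by rewrite Xd.
have [Xn Xn1|Xn _] := boolP (X (iter n phi d)); last exact: IH.
by exists (iter n phi d); rewrite fconnect_iter.
Qed.

(** Otherwise a cycle leaves [p.1] exactly along [p] and [q]. By [potential_toggle] the value at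
    [s p] is that at [q], hence that at [p], as both lie on one face; but turning from [p] to [s p]
    crosses the cycle. *)
Lemma same_face_heads (F : {set T * T}) p q : F \in faces e s -> p \in F -> q \in F ->
  p.1 = q.1 ->
  connect (avoid e [set p.1]) p.2 q.2 -> p = q.
Proof.
move=> hF pF qF pq cpq; apply/eqP/negPn/negP => npq.
have [dp dq] := (face_dart hF pF, face_dart hF qF).
have vq : e p.1 q.2 by rewrite pq.
have [Z [f [pf Zv _]]] := cycle_through_vertex dp vq cpq.
have Zp d : d.1 = p.1 -> Z d = (d == p) (+) (d == q).
  by case: d p q pq Zv {npq cpq vq dp dq pF qF} => a b [c d] [g h] /= -> Zv ->;
    rewrite Zv !xpair_eqE eqxx.
have fsp : f (s p) = f q.
  apply: potential_toggle pf _ _ erefl _ _ => // d _ dp1 /negPf n1 /negPf n2.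
  by rewrite Zp // n1 n2.
move: fsp; rewrite (potential_rot pf (dp :
  dart e p)) Zp // eqxx (negPf npq) (potential_face hF pf pF qF).
by case: (f q).
Qed.

(** If the face passed twice through [v], its two heads would lie in different components of G - v
    by [same_face_heads]. A cycle through [v] inside the component [K] of the first head then
    encloses the face, although the face has a vertex outside [K] and [v], which nothing on the
    cycle can enclose. *)
Lemma internal_face_simple (F : {set T * T}) p q : F \in internal_faces P ->
  p \in F -> q \in F -> p.1 = q.1 -> p = q.
Proof.
move=> iF pF qF pq; have hF := internal_face iF.
apply/eqP/negPn/negP => npq; set v := p.1.
pose K u := connect (avoid e [set v]) p.2 u.
have nK : ~~ K q.2.
  by apply: contra npq => h; apply/eqP; apply: same_face_heads hF pF qF pq h.
have [dp dq] := (face_dart hF pF, face_dart hF qF).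
have neq x y : e x y -> x != y by apply: contraTneq => ->; rewrite e_irr.
have p2v : p.2 \notin [set v] by rewrite inE eq_sym; apply: neq.
have q2v : q.2 != v by rewrite eq_sym /v pq; apply: neq.
have Kv u : K u -> u != v by move=> /(connect_avoid_notin p2v); rewrite inE.
have Ke x y : K x -> e x y -> y != v -> K y.
  move=> Kx exy yv; apply: connect_trans (Kx) _; apply: connect1.
  by rewrite /avoid /= exy !inE yv Kv.
pose X : pred (T * T) := fun d => K d.1 || ((d.1 == v) && K d.2).
(* Every face meeting both sides leaves the [K]-side through a corner at [v]. *)
have leave G d d' : G \in faces e s -> d \in G -> d' \in G -> X d -> ~~ X d' ->
    exists a, [/\ K a, e v a & s (v, a) \in G].
  move=> hG dG d'G Xd Xd'; have [c [dc Xc nXc]] :=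
    orbit_exit (face_connect hG dG d'G) Xd Xd'.
  have cG : c \in G by rewrite (mem_face _ hG) in dG; rewrite -(eqP dG) inE.
  have dc' := face_dart hG cG.
  have [_ c1] : dart e (phi c) /\ (phi c).1 = c.2.
    by have [_ sd _] := s_rot; apply: (sd (rev_dart c)); rewrite dart_rev.
  have cv : c.2 = v.
    apply/eqP/negPn/negP => cv; case/negP: nXc; rewrite /X c1.
    case/orP: Xc => [Kc|/andP[_ ->]//]; by rewrite (Ke _ _ Kc).
  have Kc : K c.1.
    case/orP: Xc => // /andP[/eqP cv1 _]; move: dc'; rewrite /dart cv cv1.
    by rewrite e_irr.
  exists c.1; split=> //; first by rewrite -cv e_sym.
  by rewrite -cv; move: cG; rewrite -(face_perm_mem _ hG).
have Xp : X p by rewrite /X eqxx /K connect0 orbT.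
have nXq : ~~ X q by rewrite /X -pq negb_or eqxx /= nK andbT; apply/negP => /Kv;
  rewrite eqxx.
have [b [Kb vb sb]] := leave F p q hF pF qF Xp nXq.
(* The outer face also meets both sides, since it passes through every vertex; so it too leaves the
   [K]-side at a corner at [v], next to [a], as the face [F] does next to [b]. *)
have [o [oO _ o1]] := outer_dart_at p.2; have [o' [o'O _ o'1]] := outer_dart_at q.2.
have [||a [Ka va sa]] := leave outer o o' outer_faces oO o'O.
- by rewrite /X o1 /K connect0.
- by rewrite /X o'1 negb_or nK (negPf q2v).
have ab : connect (avoid e [set v]) a b.
  by apply: connect_trans Kb; rewrite avoid_connect_sym.
have [Z [f [pf Zv Zo]]] := cycle_through_vertex va vb ab.
have nab : a != b by apply: contraTneq sa => ->; apply: internal_face_outer sb.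
have fsa : f (s (v, a)) = f (v, b).
  apply: (potential_toggle (v := v) pf) => // -[x y] _ /= ->.
  by rewrite Zv !xpair_eqE eqxx /= => /negPf -> /negPf ->.
have fsb : f (s (v, b)) = true.
  rewrite (potential_rot pf (vb : dart e (v, b))) -fsa Zv eqxx eq_sym (negPf nab).
  by case: pf => _ _ ->.
have phiq : phi q \in F by rewrite (face_perm_mem _ hF).
have [_ phiq1] : dart e (phi q) /\ (phi q).1 = q.2.
  by have [_ sd _] := s_rot; apply: (sd (rev_dart q)); rewrite dart_rev.
have : f (phi q) = false.
  apply: (potential_off pf (v := q.2)); rewrite // ?(face_dart hF phiq) // => w.
  apply: Zo => //; apply: contra nK; apply: connect_trans Ka.
by rewrite (potential_face hF pf phiq sb) fsb.
Qed.

(** * Internal faces *)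

Definition face_length (F : {set T * T}) : nat := #|F|.

Definition face_vertices (F : {set T * T}) : {set T} := [set d.1 | d in F].

Definition corner (d : T * T) (i : nat) : T := (iter i phi d).1.

Lemma corner_iter d m n : corner (iter m phi d) n = corner d (n + m).
Proof. by rewrite /corner iterD. Qed.

Lemma face_perm_origin d : dart e d -> (phi d).1 = d.2.
Proof.
by move=> dd; have [_ sd _] := s_rot; apply: (sd (rev_dart d) _).2; rewrite dart_rev.
Qed.

Section InternalFace.
Variable F : {set T * T}.
Hypothesis iF : F \in internal_faces P.
Let hF := internal_face iF.

Lemma iter_mem_face d i : d \in F -> iter i phi d \in F.
Proof. by move=> dF; elim: i => //= i; rewrite (face_perm_mem _ hF). Qed.

Lemma iter_corner d i : d \in F -> iter i phi d = (corner d i, corner d i.+1).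
Proof.
move=> dF; rewrite /corner /= face_perm_origin -?surjective_pairing //.
exact/(face_dart hF)/iter_mem_face.
Qed.

Lemma edge_corner d i : d \in F -> e (corner d i) (corner d i.+1).
Proof.
by move=> dF; have := face_dart hF (iter_mem_face i dF); rewrite iter_corner.
Qed.

Lemma order_face d : d \in F -> order phi d = face_length F.
Proof.
rewrite (mem_face _ hF) => /eqP <-; apply: eq_card => q.
by rewrite [RHS]inE.
Qed.

Lemma mem_face_orbit d x : d \in F -> (x \in F) = (x \in traject phi d (face_length F)).
Proof.
move=> dF; rewrite -(order_face dF) -/(orbit phi d) -fconnect_orbit.
by move: dF; rewrite {1}(mem_face _ hF) => /eqP <-; rewrite inE.
Qed.

Lemma face_period d : d \in F -> iter (face_length F) phi d = d.
Proof. by move=> dF; rewrite -(order_face dF) iter_order //; apply: face_perm_inj. Qed.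

Lemma corner_inj d i j : d \in F -> i < face_length F -> j < face_length F ->
  corner d i = corner d j -> i = j.
Proof.
move=> dF ik jk ij.
have {}ij := internal_face_simple iF (iter_mem_face i dF) (iter_mem_face j dF) ij.
rewrite -(order_face dF) in ik jk.
have u := orbit_uniq phi d; rewrite /orbit in u.
apply/eqP; rewrite -(nth_uniq d _ _ u) ?size_traject //.
by rewrite !nth_traject // ij.
Qed.

Lemma corner_neq d i j : d \in F -> i < face_length F -> j < face_length F -> i != j ->
  corner d i != corner d j.
Proof. by move=> dF ik jk; apply: contraNneq => /(corner_inj dF ik jk) ->. Qed.

Lemma corner_period d : d \in F -> corner d (face_length F) = d.1.
Proof. by move=> dF; rewrite /corner face_period. Qed.

Lemma corner_face_vertices d i : d \in F -> corner d i \in face_vertices F.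
Proof. by move=> dF; apply: imset_f; apply: iter_mem_face. Qed.

Lemma face_verticesP d v : d \in F -> v \in face_vertices F ->
  exists2 i, i < face_length F & v = corner d i.
Proof.
move=> dF /imsetP[q qF ->].
have dq := face_connect hF dF qF; exists (findex phi d q).
  by rewrite -(order_face dF) findex_max.
by rewrite /corner iter_findex.
Qed.

Lemma card_face_vertices : #|face_vertices F| = face_length F.
Proof.
by apply: card_in_imset => p q pF qF; apply: (internal_face_simple iF).
Qed.

(** The tool behind the structural lemmas: one vertex missed by the chain puts the whole face
    outside. *)
Lemma potential_off_face Z f w c : potential Z f -> w \in face_vertices F ->
  (forall u, Z (w, u) = false) -> c \in F -> f c = false.
Proof.
move=> pf /imsetP[q qF wq] Zw cF; rewrite (potential_face hF pf cF qF).
exact: potential_off pf Zw _ (face_dart hF qF) (esym wq).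
Qed.

Definition arc (d : T * T) (n : nat) := [seq x.2 | x <- traject phi d n].

Lemma arc_path d n : d \in F -> path e d.1 (arc d n).
Proof.
elim: n d => //= n IH d dF; have dd := face_dart hF dF; apply/andP; split => //.
rewrite -(face_perm_origin dd); apply: IH; by rewrite (face_perm_mem _ hF).
Qed.

Lemma last_arc d n : d \in F -> last d.1 (arc d n) = corner d n.
Proof.
elim: n d => //= n IH d dF; have dd := face_dart hF dF.
by rewrite -(face_perm_origin dd) IH ?(face_perm_mem _ hF) // /corner -iterSr.
Qed.

Lemma mem_arc d n v : d \in F -> v \in d.1 :: arc d n ->
  exists2 j, j <= n & v = corner d j.
Proof.
elim: n d => [|n IH] d dF.
  by rewrite inE => /eqP ->; exists 0.
rewrite inE => /predU1P[->|]; first by exists 0.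
rewrite /arc /= -/(arc _ _) -(face_perm_origin (face_dart hF dF)) => /IH[].
  by rewrite (face_perm_mem _ hF).
by move=> j jn ->; exists j.+1; rewrite // /corner -iterSr.
Qed.

Lemma arc_off d n v w : d \in F -> (forall j, j <= n -> v != corner d j) ->
  walk_parity d.1 (arc d n) (v, w) = false.
Proof.
by move=> dF h; apply: walk_parity_off; apply/negP => /(mem_arc dF)[j /h/eqP].
Qed.

Lemma arc_parity d n q : d \in F -> uniq (traject phi d n) ->
  walk_parity d.1 (arc d n) q
  = (q \in traject phi d n) (+) (rev_dart q \in traject phi d n).
Proof.
elim: n d => //= n IH d dF /andP[dn un]; have dd := face_dart hF dF.
rewrite -(face_perm_origin dd) IH ?(face_perm_mem _ hF) // (face_perm_origin dd).
rewrite !inE -!surjective_pairing.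
have -> : (q == (d.2, d.1)) = (rev_dart q == d) by rewrite (can2_eq (@rev_dartK T) (@rev_dartK T)).
have aux (a b : bool) : ~~ (a && b) -> a || b = a (+) b by case: a b => -[].
have dsj x : ~~ ((x == d) && (x \in traject phi (phi d) n)).
  by apply: contra dn => /andP[/eqP <-].
by rewrite (aux (q == d)) // (aux (rev_dart q == d)) // addbACA.
Qed.

Lemma face_edges_split d m q : d \in F -> m <= face_length F ->
  face_edges F q = walk_parity d.1 (arc d m) q
    (+) walk_parity (corner d m) (arc (iter m phi d) (face_length F - m)) q.
Proof.
move=> dF mk; rewrite -(last_arc m dF) -walk_parity_cat /arc -map_cat -trajectD subnKC //.
have := orbit_uniq phi d; rewrite /orbit (order_face dF) => u.
rewrite -/(arc d (face_length F)) arc_parity // /face_edges.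
by rewrite -!(mem_face_orbit _ dF).
Qed.

(** A face of length 1 would be a loop. A face of length 2 would consist of the two darts of one
    edge; its boundary is then the zero chain, which encloses nothing, not even the face. *)
Lemma internal_face_size_gt2 : 2 < face_length F.
Proof.
have /imsetP[d dd Fd] := hF; have dF : d \in F by rewrite Fd mem_face_of.
have k0 : 0 < face_length F by apply/card_gt0P; exists d.
have neq x y : e x y -> x != y by apply: contraTneq => ->; rewrite e_irr.
case k1 : (face_length F) k0 (face_period dF) => [//|[|[|//]]] _ /=.
  by have /neq := edge_corner 0 dF; rewrite /corner /= => + h; rewrite h eqxx.
move=> p2.
have revd : phi d = rev_dart d.
  by have := iter_corner 1 dF; rewrite /corner /= p2 (face_perm_origin dd).
have := potential_off_face (face_potential iF) (corner_face_vertices 0 dF) _ dF.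
rewrite dF => h; suff: true = false by []; apply: h => u; rewrite /face_edges.
have mF x : (x \in F) = (x == d) || (x == rev_dart d).
  by rewrite (mem_face_orbit _ dF) k1 /= !inE revd.
rewrite !mF !(can2_eq (@rev_dartK T) (@rev_dartK T)) rev_dartK orbC.
by rewrite addbb.
Qed.

(* The path [a q b] splits the boundary of [F] into two cycles, each missing
   a vertex of [F]; so neither encloses [F], although their sum does. *)
Lemma face_ear a b q : a \in face_vertices F -> b \in face_vertices F -> a != b ->
  path e a (rcons q b) -> {in q, forall z, z \notin face_vertices F} ->
  (a, b) \in F \/ (b, a) \in F.
Proof.
move=> aF bF nab qP qF; case/imsetP: aF => d dF ad; subst a.
have [m mk bm] := face_verticesP dF bF; subst b.
have m0 : 0 < m by rewrite lt0n; apply: contra nab => /eqP ->.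
have dk1 := corner_period dF.
have [m1|m1] := eqVneq m 1.
  by left; have := iter_mem_face 0 dF; rewrite iter_corner // m1.
have [mk1|mk1] := eqVneq m.+1 (face_length F).
  by right; have := iter_mem_face m dF; rewrite iter_corner // mk1 dk1.
exfalso; pose Q := walk_parity d.1 (rcons q (corner d m)).
pose Z1 := walk_parity d.1 (arc d m).
pose Z2 := walk_parity (corner d m) (arc (iter m phi d) (face_length F - m)).
have mF := iter_mem_face m dF.
have cQ : chain Q by apply: chain_walk.
have c1 : chain Z1 by apply/chain_walk/arc_path.
have c2 : chain Z2 by apply/chain_walk/arc_path.
have [v|f1 p1] := cycle_potential (chain_add cQ c1).
  rewrite boundary_add /boundary !walk_parity_boundary last_rcons last_arc //.
  by rewrite addbb.
have [v|f2 p2] := cycle_potential (chain_add cQ c2).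
  rewrite boundary_add /boundary !walk_parity_boundary last_rcons last_arc //.
  rewrite corner_iter subnK ?(ltnW mk) // dk1 [(_ == corner d m) (+) _]addbC.
  by rewrite addbb.
have Qoff w u : w \in face_vertices F -> w != d.1 -> w != corner d m -> Q (w, u) = false.
  move=> wF wd wm; apply: walk_parity_off; rewrite inE mem_rcons inE !negb_or wd wm /=.
  by apply: contraL wF; apply: qF.
have cne i j := @corner_neq d i j dF.
(* Here 2 <= [m] and [m.+1] < [face_length F], so each arc has an interior corner, missed by the
   cycle through the other arc: [corner d m.+1] now, [corner d 1] below. *)
have f1d : f1 d = false.
  apply: (potential_off_face p1 (corner_face_vertices m.+1 dF) _ dF) => u.
  rewrite /add_chain Qoff ?corner_face_vertices //; [|by apply: (@cne _ 0);
    clear -m0 m1 mk mk1; lia|by apply: cne; clear -m0 m1 mk mk1; lia].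
  by apply: arc_off => // j jm; apply: cne; clear -jm m0 m1 mk mk1; lia.
have f2d : f2 d = false.
  apply: (potential_off_face p2 (corner_face_vertices 1 dF) _ dF) => u.
  rewrite /add_chain Qoff ?corner_face_vertices //; [|by apply: (@cne _ 0);
    clear -m0 m1 mk mk1; lia|by apply: cne; clear -m0 m1 mk mk1; lia].
  apply: arc_off => // j jm; rewrite corner_iter.
  have [jk|jk] := eqVneq (j + m) (face_length F); last by apply: cne;
    clear -jk jm m0 m1 mk mk1; lia.
  by rewrite jk dk1; apply: (@cne _ 0); clear -mk m0; lia.
have := potential_eq (potential_add p1 p2) (face_potential iF) _ (face_dart hF dF).
rewrite dF /add_chain f1d f2d => h; suff: false = true by []; apply: h => x.
by rewrite (face_edges_split x dF (ltnW mk)) addbACA addbb.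
Qed.

(* As in [face_ear], the tripod splits the boundary of [F] into three cycles. *)
Lemma face_tripod_corners d m n h qa qb qc : d \in F -> 0 < m -> m < n ->
  n < face_length F ->
  path e h (rcons qa (corner d 0)) -> path e h (rcons qb (corner d m)) ->
  path e h (rcons qc (corner d n)) ->
  {in [:: h] ++ qa ++ qb ++ qc, forall z, z \notin face_vertices F} -> False.
Proof.
move=> dF m0 mn nk pa pb pc qF.
have [dm dn] := (iter_mem_face m dF, iter_mem_face n dF).
pose Qa := walk_parity h (rcons qa (corner d 0)).
pose Qb := walk_parity h (rcons qb (corner d m)).
pose Qc := walk_parity h (rcons qc (corner d n)).
pose Z1 := walk_parity d.1 (arc d m).
pose Z2 := walk_parity (corner d m) (arc (iter m phi d) (n - m)).
pose Z3 := walk_parity (corner d n) (arc (iter n phi d) (face_length F - n)).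
have [ca cb cc] : [/\ chain Qa, chain Qb & chain Qc] by split; apply: chain_walk.
have [c1 c2 c3] : [/\ chain Z1, chain Z2 & chain Z3] by split; apply/chain_walk/arc_path.
have [v|f1 p1] := cycle_potential (chain_add (chain_add ca cb) c1).
  rewrite !boundary_add /boundary !walk_parity_boundary !last_rcons !last_arc //.
  by rewrite /corner /=; do !case: (_ == _).
have [v|f2 p2] := cycle_potential (chain_add (chain_add cb cc) c2).
  rewrite !boundary_add /boundary !walk_parity_boundary !last_rcons !last_arc //.
  by rewrite corner_iter subnK ?(ltnW mn) //; do !case: (_ == _).
have [v|f3 p3] := cycle_potential (chain_add (chain_add cc ca) c3).
  rewrite !boundary_add /boundary !walk_parity_boundary !last_rcons !last_arc //.
  rewrite corner_iter subnK ?(ltnW nk) // corner_period //.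
  by rewrite /corner /=; do !case: (_ == _).
have Qoff w u q i : {subset q <= [:: h] ++ qa ++ qb ++ qc} -> w \in face_vertices F ->
    w != corner d i -> walk_parity h (rcons q (corner d i)) (w, u) = false.
  move=> qs wF wi; apply: walk_parity_off; rewrite inE mem_rcons inE !negb_or wi /=.
  have nin z : z \in [:: h] ++ qa ++ qb ++ qc -> w != z.
    by move=> /qF; apply: contraNneq => <-.
  by rewrite nin ?inE ?eqxx //=; apply/negP => /qs /nin; rewrite eqxx.
have sa : {subset qa <= [:: h] ++ qa ++ qb ++ qc} by move=> z zq; rewrite !mem_cat zq !orbT.
have sb : {subset qb <= [:: h] ++ qa ++ qb ++ qc} by move=> z zq; rewrite !mem_cat zq !orbT.
have sc : {subset qc <= [:: h] ++ qa ++ qb ++ qc} by move=> z zq; rewrite !mem_cat zq !orbT.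
have cne i j := @corner_neq d i j dF.
(* Each of the three cycles misses the foot of the leg it does not use. *)
have f1d : f1 d = false.
  apply: (potential_off_face p1 (corner_face_vertices n dF) _ dF) => u.
  rewrite /add_chain /Qa /Qb !Qoff ?corner_face_vertices //;
    try by apply: cne; clear -m0 mn nk; lia.
  by apply: arc_off => // j jm; apply: cne; clear -jm m0 mn nk; lia.
have f2d : f2 d = false.
  apply: (potential_off_face p2 (corner_face_vertices 0 dF) _ dF) => u.
  rewrite /add_chain /Qb /Qc !Qoff ?corner_face_vertices //;
    try by apply: cne; clear -m0 mn nk; lia.
  by apply: arc_off => // j jm; rewrite corner_iter; apply: cne; clear -jm m0 mn nk; lia.
have f3d : f3 d = false.
  apply: (potential_off_face p3 (corner_face_vertices m dF) _ dF) => u.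
  rewrite /add_chain /Qc /Qa !Qoff ?corner_face_vertices //;
    try by apply: cne; clear -m0 mn nk; lia.
  apply: arc_off => // j jm; rewrite corner_iter.
  have [jk|jk] := eqVneq (j + n) (face_length F); last by apply: cne;
    clear -jk jm m0 mn nk; lia.
  by rewrite jk corner_period //; apply: (@cne _ 0); clear -m0 mn nk; lia.
have := potential_eq (potential_add (potential_add p1 p2) p3) (face_potential iF) _ (face_dart hF dF).
rewrite dF /add_chain f1d f2d f3d => H; suff: false = true by []; apply: H => x.
rewrite (face_edges_split x dF (ltnW nk)) -[in arc d n](subnKC (ltnW mn)).
rewrite /arc trajectD map_cat -!/(arc _ _) walk_parity_cat last_arc //.
rewrite -/(Qa x) -/(Qb x) -/(Qc x) -/(Z1 x) -/(Z2 x) -/(Z3 x).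
by case: (Qa x); case: (Qb x); case: (Qc x); case: (Z1 x); case: (Z2 x); case: (Z3 x).
Qed.

(** The attachments on [F] of the component of G - F that contains [r]. *)
Definition attached (r z : T) :=
  z \in face_vertices F /\ exists2 t, connect (avoid e (face_vertices F)) r t & e t z.

Lemma attached_path r z : r \notin face_vertices F -> attached r z ->
  exists q, [/\ path e r (rcons q z), z \in face_vertices F &
    {in q, forall x, x \notin face_vertices F}].
Proof.
move=> rF [zF [t rt tz]]; have [p [pP pt pF _]] := avoid_connect rF rt.
exists p; rewrite rcons_path pP -pt tz; split => // x xp; apply: pF.
by rewrite inE xp orbT.
Qed.

Lemma face_tripod r a b c : r \notin face_vertices F ->
  attached r a -> attached r b -> attached r c ->
  a != b -> b != c -> a != c -> False.
Proof.
move=> rF /(attached_path rF)[qa [pa aF qaF]] /(attached_path rF)[qb [pb bF qbF]].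
move=> /(attached_path rF)[qc [pc cF qcF]] ab bc ac.
case/imsetP: aF => d dF ad; subst a.
have [m mk bm] := face_verticesP dF bF; have [n nk cn] := face_verticesP dF cF.
have qF : {in [:: r] ++ qa ++ qb ++ qc, forall z, z \notin face_vertices F}.
  move=> z; rewrite !mem_cat inE => /or4P[/eqP ->|/qaF|/qbF|/qcF] //.
have m0 : 0 < m by rewrite lt0n; apply: contra ab => /eqP m0; rewrite bm m0.
have n0 : 0 < n by rewrite lt0n; apply: contra ac => /eqP n0; rewrite cn n0.
subst b c; case: (ltngtP m n) => mn.
- exact: face_tripod_corners dF m0 mn nk pa pb pc qF.
- apply: (face_tripod_corners dF n0 mn mk pa pc pb) => z zq; apply: qF.
  by move: zq; rewrite !mem_cat [(z \in qc) || _]orbC.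
by rewrite mn eqxx in bc.
Qed.

(** A path through the component joins the two attachments off [F], so it is an ear for
    [face_ear]. *)
Lemma attached_adjacent r a b : r \notin face_vertices F ->
  attached r a -> attached r b -> a != b -> (a, b) \in F \/ (b, a) \in F.
Proof.
move=> rF [aF [ta rta tae]] [bF [tb rtb tbe]] ab.
have taF := connect_avoid_notin rF rta.
have tab : connect (avoid e (face_vertices F)) ta tb.
  by apply: connect_trans rtb; rewrite avoid_connect_sym.
have [p [pP ptb pF _]] := avoid_connect taF tab.
apply: (face_ear (q := ta :: p)) => //.
by rewrite /= e_sym tae rcons_path pP -ptb.
Qed.

Lemma attached_edge r : r \notin face_vertices F ->
  exists y z, (y, z) \in F /\ forall x, attached r x -> x = y \/ x = z.
Proof.
move=> rF.
pose N := [set z in face_vertices F |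
  [exists t, connect (avoid e (face_vertices F)) r t && e t z]].
have NP z : reflect (attached r z) (z \in N).
  rewrite inE; apply: (iffP andP) => -[zF].
    by case/existsP => t /andP[rt tz]; split => //; exists t.
  by case=> t rt tz; split => //; apply/existsP; exists t; rewrite rt.
have [N0|[x xN]] := set_0Vmem N.
  have /imsetP[d dd Fd] := hF; exists d.1, d.2; split => [|x /NP].
    by rewrite -surjective_pairing Fd mem_face_of.
  by rewrite N0 inE.
have [N1|[y]] := set_0Vmem (N :\ x).
  have /imsetP[d dF xd] : x \in face_vertices F by case/NP: xN.
  exists d.1, d.2; rewrite -surjective_pairing; split => // y /NP yN; left.
  apply/eqP; rewrite -xd; apply/negPn/negP => yx.
  by have := in_set0 y; rewrite -N1 in_setD1 yx yN.
rewrite in_setD1 => /andP[yx /NP ay]; move/NP: xN => ax.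
have third z : attached r z -> z = x \/ z = y.
  move=> az; have [->|zx] := eqVneq z x; first by left.
  have [->|zy] := eqVneq z y; first by right.
  by case: (face_tripod rF ax ay az); rewrite // eq_sym.
have [xy|yx'] := attached_adjacent rF ay ax yx.
  by exists y, x; split => // z /third[]->; [right|left].
by exists x, y.
Qed.

Lemma face_chordless a b : a \in face_vertices F -> b \in face_vertices F -> e a b ->
  (a, b) \in F \/ (b, a) \in F.
Proof.
move=> aF bF ab; apply: (face_ear (q := [::])) => //=; last by rewrite ab.
by apply: contraTneq ab => ->; rewrite e_irr.
Qed.

Lemma edge_corners d i j : d \in F -> i < face_length F -> j < face_length F ->
  e (corner d i) (corner d j) ->
  j = i.+1 \/ i = j.+1 \/ (i = 0 /\ j = (face_length F).-1) \/ (j = 0 /\ i = (face_length F).-1).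
Proof.
move=> dF.
have step a b : a < face_length F -> b < face_length F -> (corner d a, corner d b) \in F ->
    b = a.+1 \/ b = 0 /\ a = (face_length F).-1.
  move=> ak bk abF.
  have := internal_face_simple iF abF (iter_mem_face a dF) erefl.
  rewrite iter_corner // => -[].
  have [a1|a1] := eqVneq a.+1 (face_length F); last first.
    by move/(corner_inj dF bk) => ->; [left|move: ak a1; clear; lia].
  rewrite a1 corner_period // => /(@corner_inj d b 0 dF bk) b0; right.
  by rewrite b0 -?a1 //; apply: leq_ltn_trans ak.
move=> ik jk /face_chordless[||/(step _ _ ik jk)|/(step _ _ jk ik)];
  rewrite ?corner_face_vertices //.
  by case=> [->|[-> ->]]; [left|do 3!right].
by case=> [->|[-> ->]]; [right; left|do 2!right; left].
Qed.

End InternalFace.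

(** The cycle through the component and the edge [uv] uses that edge once, so exactly one side of
    [uv] is enclosed. The face on that side is internal, and all its vertices lie on the cycle,
    since a vertex off the cycle would put the face outside. *)
Lemma internal_face_at_edge u v t1 t2 : e u v -> t1 \notin [set u; v] ->
  connect (avoid e [set u; v]) t1 t2 -> e u t1 -> e t2 v ->
  exists F, [/\ F \in internal_faces P, (u, v) \in F \/ (v, u) \in F &
    forall w, w \in face_vertices F -> w != u -> w != v ->
      connect (avoid e [set u; v]) t1 w].
Proof.
move=> uv t1S t12 ut1 t2v; have [p [pP pt2 pS pc]] := avoid_connect t1S t12.
have vu : e v u by rewrite e_sym.
have wP : path e u (t1 :: p ++ [:: v; u]) by rewrite /= ut1 cat_path pP -pt2 /= t2v vu.
have [v0|f pf] := cycle_potential (chain_walk wP).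
  by rewrite /boundary walk_parity_boundary /= last_cat /= addbb.
have ne x : x \in t1 :: p -> (x == u) = false /\ (x == v) = false.
  by move=> /pS; rewrite !inE negb_or => /andP[/negPf -> /negPf ->].
have Zuv : walk_parity u (t1 :: p ++ [:: v; u]) (u, v) = true.
  rewrite /= walk_parity_cat walk_parity_off; last first.
    by apply/negP => /ne[]; rewrite eqxx.
  have [t1u t1v] := ne t1 (mem_head _ _); have [t2u t2v'] :
    (t2 == u) = false /\ (t2 == v) = false.
    by apply: ne; rewrite pt2 mem_last.
  have nuv : (u == v) = false by apply: contraTF uv => /eqP ->; rewrite e_irr.
  rewrite -pt2 /= !xpair_eqE !eqxx [v == t1]eq_sym [u == t1]eq_sym [u == t2]eq_sym.
  by rewrite t1u t1v t2u nuv.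
have main d : dart e d -> d = (u, v) \/ d = (v, u) -> f d = true ->
  exists F, [/\ F \in internal_faces P, (u, v) \in F \/ (v, u) \in F &
    forall w, w \in face_vertices F -> w != u -> w != v ->
      connect (avoid e [set u; v]) t1 w].
  move=> dd dE fd; have hF : face_of s d \in faces e s by apply: imset_f.
  have iF : face_of s d \in internal_faces P.
    rewrite inE hF; apply: contraTneq (mem_face_of s d) => FO.
    rewrite FO; apply/negP => dO; have [_ _ h] := pf.
    by rewrite h in fd.
  exists (face_of s d); split => //.
    by case: dE => <-; [left|right]; apply: mem_face_of.
  move=> w wF wu wv; apply: pc; apply/negPn/negP => wp.
  have := potential_off_face iF pf wF _ (mem_face_of s d); rewrite fd.
  move=> h; suff: true = false by []; apply: h => x; apply: walk_parity_off.
  rewrite inE -cat_cons mem_cat !inE negb_or wu negb_or wp negb_or wu wv //.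
have [fuv|fuv] := boolP (f (u, v)); first by apply: (main (u, v)) => //; left.
apply: (main (v, u)) => //; first by right.
by have [_ h _] := pf; have := h (u, v) uv; rewrite (negPf fuv) Zuv.
Qed.

(** If [a] and [b] are not consecutive on [F1], they cut each face boundary into two arcs. Some arc
    of [F1] forms with either arc of [F2] a closed chain enclosing [F1]. A vertex of [F1] off that
    arc must then lie on both arcs of [F2], which meet only in [a] and [b]. *)
Lemma two_faces_share (F1 F2 : {set T * T}) a b : F1 \in internal_faces P ->
  F2 \in internal_faces P ->
  F1 != F2 -> a \in face_vertices F1 -> a \in face_vertices F2 ->
  b \in face_vertices F1 -> b \in face_vertices F2 -> a != b ->
  (a, b) \in F1 \/ (b, a) \in F1.
Proof.
move=> i1 i2 n12 /imsetP[d1 d1F ad1] /imsetP[d2 d2F ad2] bF1 bF2 ab.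
have [h1 h2] := (internal_face i1, internal_face i2).
have [m mk bm] := face_verticesP i1 d1F bF1.
have [n nk bn] := face_verticesP i2 d2F bF2.
have m0 : 0 < m by rewrite lt0n; apply: contra ab => /eqP m0; rewrite bm ad1 m0.
have n0 : 0 < n by rewrite lt0n; apply: contra ab => /eqP n0; rewrite bn ad2 n0.
have [m1|m1] := eqVneq m 1.
  by left; have := iter_mem_face i1 0 d1F; rewrite (iter_corner i1) // bm m1 ad1.
have [mk1|mk1] := eqVneq m.+1 (face_length F1).
  right; have := iter_mem_face i1 m d1F.
  by rewrite (iter_corner i1) // mk1 (corner_period i1) // bm ad1.
exfalso.
have dm1 := iter_mem_face i1 m d1F; have dn2 := iter_mem_face i2 n d2F.
pose Z1 := walk_parity d1.1 (arc d1 m).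
pose Z1' := walk_parity (corner d1 m) (arc (iter m phi d1) (face_length F1 - m)).
pose Z2 := walk_parity d2.1 (arc d2 n).
pose Z2' := walk_parity (corner d2 n) (arc (iter n phi d2) (face_length F2 - n)).
have c1 : chain Z1 by apply/chain_walk/(arc_path i1).
have c2 : chain Z2 by apply/chain_walk/(arc_path i2).
have [v|g pg] := cycle_potential (chain_add c1 c2).
  rewrite !boundary_add /boundary !walk_parity_boundary (last_arc i1) ?(last_arc i2) //.
  by rewrite -ad1 -ad2 -bm -bn; do !case: (_ == _).
have d1F2 : d1 \notin F2.
  by apply: contra n12; move: d1F; rewrite (mem_face _ h1) (mem_face _ h2) => /eqP ->.
have S1 := fun x => face_edges_split i1 x d1F (ltnW mk).
have S2 := fun x => face_edges_split i2 x d2F (ltnW nk).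
have cne1 i j := @corner_neq _ i1 d1 i j d1F.
have cne2 i j := @corner_neq _ i2 d2 i j d2F.
have meet w : w != a -> w != b -> w \in d2.1 :: arc d2 n ->
    w \in corner d2 n :: arc (iter n phi d2) (face_length F2 - n) -> False.
  move=> wa wb /(mem_arc i2 d2F)[i iN wi] /(mem_arc i2 dn2)[j jN].
  rewrite corner_iter wi; move: wa wb; rewrite ad2 bn wi => wa wb.
  have {wb}ni : i != n by apply: contraNneq wb => ->.
  have [->|jk] := eqVneq (j + n) (face_length F2).
    by rewrite (corner_period i2) // => h; rewrite h eqxx in wa.
  apply/eqP; apply: cne2; clear -iN nk ni jN jk; lia.
have both Z w f f' : w \in face_vertices F1 -> w != a -> w != b ->
    (forall u, Z (w, u) = false) -> potential (add_chain Z Z2) f ->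
    potential (add_chain Z Z2') f' -> f d1 = true -> f' d1 = true -> False.
  move=> wF wa wb Zw pf pf' fd fd'.
  have on p x h : potential (add_chain Z (walk_parity x p)) h -> h d1 = true ->
    w \in x :: p.
    move=> ph; apply: contraTT => wp; apply/negbT.
    apply: (potential_off_face i1 ph wF _ d1F) => u.
    by rewrite /add_chain Zw walk_parity_off.
  by apply: (meet w) => //; [apply: on pf fd|apply: on pf' fd'].
have P2 := potential_add pg (face_potential i2).
(* Replacing [Z2] by [Z2'] adds the boundary of [F2] and keeps the value at [d1]; replacing [Z1] by
   [Z1'] adds that of [F1] and flips it. So the value of [g] decides which arc of [F1] is taken. *)
case gd: (g d1).
  apply: (both Z1 (corner d1 m.+1) g (add_chain g (fun d => d \in F2))) => //.
  - exact: corner_face_vertices.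
  - by rewrite ad1; apply: (@cne1 _ 0); clear -m0 mk mk1; lia.
  - by rewrite bm; apply: cne1; clear -m0 mk mk1; lia.
  - by move=> u; apply: (arc_off i1) => // j jm; apply: cne1; clear -jm m0 mk mk1; lia.
  - apply: potential_ext P2 => x; rewrite /add_chain S2 -/(Z2 x) -/(Z2' x).
    by case: (Z1 x); case: (Z2 x); case: (Z2' x).
  by rewrite /add_chain gd (negPf d1F2).
have P1 := potential_add pg (face_potential i1).
have P12 := potential_add P2 (face_potential i1).
apply: (both Z1' (corner d1 1) (add_chain g (fun d => d \in F1))
  (add_chain (add_chain g (fun d => d \in F2)) (fun d => d \in F1))) => //.
- exact: corner_face_vertices.
- by rewrite ad1; apply: (@cne1 _ 0); clear -m0 mk; lia.
- by rewrite bm; apply: cne1; clear -m0 mk m1; lia.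
- move=> u; apply: (arc_off i1) => // j jm; rewrite corner_iter.
  have [jk|jk] := eqVneq (j + m) (face_length F1); last by apply: cne1;
    clear -jk jm m0 m1 mk; lia.
  by rewrite jk (corner_period i1) //; apply: (@cne1 _ 0); clear -m0 mk; lia.
- apply: potential_ext P1 => x; rewrite /add_chain S1 -/(Z1 x) -/(Z1' x).
  by case: (Z1 x); case: (Z1' x); case: (Z2 x).
- apply: potential_ext P12 => x;
  rewrite /add_chain S1 S2 -/(Z1 x) -/(Z1' x) -/(Z2 x) -/(Z2' x).
  by case: (Z1 x); case: (Z1' x); case: (Z2 x); case: (Z2' x).
- by rewrite /add_chain gd d1F.
by rewrite /add_chain gd d1F (negPf d1F2).
Qed.

(** * The robber's strategy *)

Definition dominates (x y : T) := (x == y) || e x y.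

Lemma dominates_corners (F : {set T * T}) d i j : F \in internal_faces P -> d \in F ->
  i < face_length F -> j < face_length F -> dominates (corner d i) (corner d j) ->
  i = j \/ j = i.+1 \/ i = j.+1 \/ (i = 0 /\ j = (face_length F).-1) \/ (j = 0 /\ i = (face_length F).-1).
Proof.
move=> iF dF ik jk /orP[/eqP|].
  by move/(corner_inj iF dF ik jk) => ->; left.
by move/(edge_corners iF dF ik jk); right.
Qed.

Lemma adjacent_attached (F : {set T * T}) c z : c \notin face_vertices F ->
  z \in face_vertices F ->
  dominates c z -> attached F c z.
Proof.
move=> cF zF /orP[/eqP cz|cz]; first by rewrite cz zF in cF.
by split => //; exists c.
Qed.

Lemma attached_connect (F : {set T * T}) c c' z :
  connect (avoid e (face_vertices F)) c c' -> attached F c' z -> attached F c z.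
Proof.
by move=> cc' [zF [t c't tz]]; split => //; exists t => //; apply: connect_trans c't.
Qed.

Lemma connect_avoid1 (S : {set T}) x y : x \notin S -> y \notin S -> dominates x y ->
  connect (avoid e S) x y.
Proof.
move=> xS yS /orP[/eqP->|xy]; first exact: connect0.
by apply: connect1; rewrite /avoid /= xy xS yS.
Qed.

Lemma dominates_sym x y : dominates x y = dominates y x.
Proof. by rewrite /dominates eq_sym e_sym. Qed.

Lemma face_dominates (F : {set T * T}) a b : F \in internal_faces P ->
  (a, b) \in F \/ (b, a) \in F -> dominates a b.
Proof.
move=> iF [] /(face_dart (internal_face iF)) h; first by rewrite /dominates (h :
  e a b) orbT.
by rewrite dominates_sym /dominates (h : e b a) orbT.
Qed.

Lemma attached_dominates (F : {set T * T}) r a b : F \in internal_faces P ->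
  r \notin face_vertices F -> attached F r a -> attached F r b -> dominates a b.
Proof.
move=> iF rF ra rb; have [->|ab] := eqVneq a b; first by rewrite /dominates eqxx.
exact: face_dominates iF (attached_adjacent iF rF ra rb ab).
Qed.

Section Robber.
Variable F : {set T * T}.
Hypothesis iF : F \in internal_faces P.
Hypothesis F5 : 4 < face_length F.
Let V := face_vertices F.

(** The robber is at [d.1], next to two mutually protecting cops. With one cop off the face, both
    face neighbours of the robber would be attachments of its component, hence adjacent; with both
    cops off, that component would have three attachments. *)
Lemma escape_corner d a b : d \in F -> a != d.1 -> b != d.1 -> dominates a b ->
  dominates a d.1 || dominates b d.1 ->
  dominates a (corner d 1) || dominates b (corner d 1) ->
  dominates a (corner d (face_length F).-1) || dominates b (corner d (face_length F).-1) -> False.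
Proof.
move=> dF.
set q := corner d 1; set p := corner d (face_length F).-1.
have dE : d.1 = corner d 0 by [].
have k1 : (face_length F).-1 < face_length F by clear -F5; lia.
have [V0 Vq Vp] : [/\ d.1 \in V, q \in V & p \in V] by rewrite dE !corner_face_vertices.
have cne i j := @corner_neq _ iF d i j dF.
have n0q : d.1 != q by apply: (@cne 0); clear -F5; lia.
have n0p : d.1 != p by apply: (@cne 0); clear -F5; lia.
have nqp : q != p by apply: cne; clear -F5; lia.
have pq : dominates q p -> False.
  have k1' : 1 < face_length F by clear -F5; lia.
  by move/(dominates_corners iF dF k1' k1); clear -F5; lia.
have cornV c : c \in V -> c != d.1 -> dominates c d.1 -> c = q \/ c = p.
  move=> cV; have [i ik ->] := face_verticesP iF dF cV => ci.
  have k0 : 0 < face_length F by clear -F5; lia.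
  rewrite dE => /(dominates_corners iF dF ik k0) [i0|].
    by rewrite i0 eqxx in ci.
  case=> [//|[->|[[_ h]|[_ ->]]]]; [by left| |by right].
  by clear -h F5; lia.
have caseII c c' : c \in V -> c' \notin V -> c != d.1 -> dominates c c' ->
  dominates c d.1 ->
    dominates c q || dominates c' q -> dominates c p || dominates c' p -> False.
  move=> cV c'V cd cc' c0 hq hp.
  have att := @adjacent_attached F c' _ c'V.
  have ac : attached F c' c by apply: att; rewrite // dominates_sym.
  case: (cornV _ cV cd c0) => ce; rewrite ce in ac hq hp.
  - case/orP: hp => [/pq//|/(att _ Vp) ap].
    exact/pq/(attached_dominates iF c'V ac ap).
  case/orP: hq => [|/(att _ Vq) aq]; first by rewrite dominates_sym => /pq.
  exact/pq/(attached_dominates iF c'V aq ac).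
wlog a0 : a b / dominates a d.1.
  move=> W ad bd ab /orP[h|h] hq hp; first by apply: (W a b); rewrite ?h.
  apply: (W b a h bd ad); first by rewrite dominates_sym.
  - by rewrite h.
  - by rewrite orbC.
  by rewrite orbC.
move=> ad bd ab _ hq hp.
have [aV|aV] := boolP (a \in V); have [bV|bV] := boolP (b \in V).
(* Both cops on the face: pure index arithmetic. Length 4 would fail, with the cops at corners 1 and
   2. *)
- have [i ik ai] := face_verticesP iF dF aV; have [j jk bj] := face_verticesP iF dF bV.
  move: ab hq hp; rewrite ai bj => /(dominates_corners iF dF ik jk) ab.
  have k1' : 1 < face_length F by clear -F5; lia.
  have i0 : i != 0 by apply: contra ad => /eqP i0; rewrite ai i0.
  have j0 : j != 0 by apply: contra bd => /eqP j0; rewrite bj j0.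
  have k0 : 0 < face_length F by clear -F5; lia.
  move: a0; rewrite ai dE => /(dominates_corners iF dF ik k0) a0.
  case/orP => /(dominates_corners iF dF _ k1') => /(_ ltac:(assumption)) h1;
  case/orP => /(dominates_corners iF dF _ k1) => /(_ ltac:(assumption)) h2;
  clear -F5 ab i0 j0 a0 h1 h2 ik jk; lia.
- exact: caseII aV bV ad ab a0 hq hp.
- have aa : attached F a b by apply: adjacent_attached.
  have ar : attached F a d.1 by apply: adjacent_attached.
  apply: (caseII b a bV aV bd); first by rewrite dominates_sym.
  - exact: attached_dominates iF aV aa ar.
  - by rewrite orbC.
  by rewrite orbC.
have con c : dominates a c || dominates b c -> c \in V -> attached F a c.
  case/orP => h cV; first exact: adjacent_attached.
  apply: attached_connect (connect_avoid1 aV bV ab) _; exact: adjacent_attached.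
apply: (face_tripod iF aV (con d.1 _ _) (con q _ _) (con p _ _)) => //.
by rewrite a0.
Qed.

Lemma no_cops_lose cs r : cops_force e cs r -> cs = [::] -> False.
Proof.
elim=> {cs r} [cs r cs' st rcs|cs r cs' st rcs _ IH] cs0; subst cs; first by case:
  cs' st rcs.
case: cs' st rcs IH => // _ _ IH.
by apply: (IH r); rewrite ?eqxx.
Qed.

Lemma cop_step1 c cs' : cop_step e [:: c] cs' ->
  exists2 c', cs' = [:: c'] & dominates c c'.
Proof.
by case: cs' => [|c' [|? ?]] //=; rewrite ?andbT ?andbF // => h; exists c'.
Qed.

Lemma cop_step2 a b cs' : cop_step e [:: a; b] cs' ->
  exists a' b', [/\ cs' = [:: a'; b'], dominates a a' & dominates b b'].
Proof.
case: cs' => [|a' [|b' [|? ?]]] //=; rewrite ?andbT ?andbF // => /andP[h h'].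
by exists a', b'.
Qed.

(** The robber passes while the cop is not adjacent and attacks it as soon as it is. *)
Lemma one_cop_loses cs r : cops_force e cs r ->
  forall c, cs = [:: c] -> ~~ dominates c r -> False.
Proof.
elim=> {cs r} [cs r cs' st rcs|cs r cs' st rcs h IH] c ? ncr; subst cs;
  have [c' ? cc'] := cop_step1 st; subst cs'.
  by move: rcs; rewrite inE => /eqP rc'; rewrite rc' cc' in ncr.
move: rcs; rewrite inE => rc'; move: h IH.
have [c'r h _|c'r _ IH] := boolP (e r c').
  by have := h c'; rewrite c'r orbT mem_head /= eqxx => /(_ isT) /no_cops_lose; apply.
have := IH r; rewrite eqxx inE (negPf rc') => /(_ isT c' erefl); apply.
by rewrite dominates_sym /dominates (negPf rc').
Qed.

(* A cop next to the robber must be backed up by the other one, otherwise it is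
   attacked; but then a neighbour of the robber on the face is free. *)
Lemma robber_survives_on_face cs r : cops_force e cs r -> forall a b, cs = [:: a; b] ->
  r \in V -> ~~ dominates a r -> ~~ dominates b r -> False.
Proof.
elim=> {cs r} [cs r cs' st rcs|cs r cs' st rcs h IH] a b ? rV nar nbr; subst cs;
  have [a' [b' [? aa' bb']]] := cop_step2 st; subst cs'.
  by move: rcs; rewrite !inE => /orP[] /eqP re; rewrite re ?aa' ?bb' in nar nbr.
move: rcs; rewrite !inE negb_or => /andP[ra' rb'].
case: (boolP (dominates a' r || dominates b' r)) => [dom|]; last first.
  rewrite negb_or => /andP[n1 n2].
  have := IH r; rewrite eqxx !inE (negPf ra') (negPf rb') => /(_ isT a' b' erefl).
  exact.
(* Unprotected cops: the robber attacks the one next to him, and the survivor is not next to his new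
   position. *)
case: (boolP (dominates a' b')) => [ab|nab]; last first.
  have nab' : (a' == b') = false by apply: contraNF nab => /eqP ->; rewrite /dominates eqxx.
  case/orP: dom => /orP[/eqP E|E]; rewrite ?E ?eqxx // in ra' rb' *.
  - have := h a'; rewrite e_sym E orbT mem_head /= eqxx => /(_ isT) /one_cop_loses.
    by apply; first reflexivity; rewrite dominates_sym.
  have := h b'; rewrite e_sym E orbT !inE eqxx orbT /= nab' eqxx => /(_ isT) /one_cop_loses.
  by apply; first reflexivity.
have /imsetP[d dF rd] := rV.
have esc r' : e r r' -> r' \in V -> ~~ (dominates a' r' || dominates b' r') -> False.
  move=> rr' r'V; rewrite negb_or => /andP[n1 n2].
  have := IH r'; rewrite rr' orbT; case: ifP => [|_ /(_ isT a' b' erefl)]; last exact.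
  rewrite !inE => /orP[] /eqP E _; rewrite -E /dominates eqxx in n1 n2 => //.
have dE : d.1 = corner d 0 by [].
apply: (escape_corner dF (a := a') (b := b')); rewrite -?rd 1?eq_sym //.
  apply/negPn/negP; apply: esc; last exact: corner_face_vertices.
  by rewrite rd dE; apply: (edge_corner iF).
apply/negPn/negP; apply: esc; last exact: corner_face_vertices.
have kE : face_length F = (face_length F).-1.+1 by clear -F5; lia.
by rewrite rd -(corner_period iF dF) e_sym {2}kE; apply: (edge_corner iF).
Qed.

Lemma card_dominated_le2 c : c \notin V -> #|[set x in V | dominates c x]| <= 2.
Proof.
move=> cV; have [y [z [_ yz]]] := attached_edge iF cV.
apply: leq_trans (subset_leq_card (_ : _ \subset mem [:: y; z])) (card_size _).
apply/subsetP => x; rewrite !inE => /andP[xV cx].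
by case: (yz x) => [|->|->]; rewrite ?eqxx ?orbT //; apply: adjacent_attached.
Qed.

Lemma card_dominated_le3 c : #|[set x in V | dominates c x]| <= 3.
Proof.
have [cV|/card_dominated_le2/leq_trans] := boolP (c \in V); last exact.
have /imsetP[d dF cd] := cV.
apply: leq_trans (subset_leq_card (_ : _ \subset mem [:: corner d 0; corner d 1;
  corner d (face_length F).-1])) (card_size _).
apply/subsetP => x; rewrite !inE => /andP[xV].
have [i ik ->] := face_verticesP iF dF xV; rewrite cd -[d.1]/(corner d 0).
have k0 : 0 < face_length F by clear -F5; lia.
case/(dominates_corners iF dF k0 ik) => [<-|]; first by rewrite eqxx.
by case=> [->|[//|[[_ ->]|[-> _]]]]; rewrite eqxx ?orbT.
Qed.

Definition face_dominated (a b : T) := forall x, x \in V -> dominates a x || dominates b x.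

Lemma face_dominated_card a b : face_dominated a b ->
  face_length F <= #|[set x in V | dominates a x]| + #|[set x in V | dominates b x]|.
Proof.
move=> dom; rewrite -(card_face_vertices iF) -cardsUI.
apply: leq_trans (leq_addr _ _); apply/subset_leq_card/subsetP => x xV.
by rewrite !inE -/V xV /= dom.
Qed.

Lemma robber_wins_undominated a b : ~ face_dominated a b ->
  ~ (forall r, cops_force e [:: a; b] r).
Proof.
move=> nd win; apply: nd => x xV; apply/negPn/negP; rewrite negb_or => /andP[na nb].
exact: robber_survives_on_face (win x) _ _ erefl xV na nb.
Qed.

Lemma face_dominated_mem a b : face_dominated a b -> a \in V \/ b \in V.
Proof.
move=> /face_dominated_card dom.
have [aV|aV] := boolP (a \in V); first by left.
have [bV|bV] := boolP (b \in V); first by right.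
move: (card_dominated_le2 aV) (card_dominated_le2 bV).
by move: #|_| #|_| dom => x y; clear -F5; lia.
Qed.

(** With [a] at corner 0, corners 2 and 3 are out of its reach as the length is at least 5, so they
    fall to [b]. *)
Lemma face_dominated_opposite a b : face_dominated a b -> a \in V ->
  exists x y, [/\ x \in V, y \in V, dominates b x, dominates b y &
    [/\ ~~ dominates a x, ~~ dominates a y, x != y & e x y]].
Proof.
move=> dom /imsetP[d dF ad]; exists (corner d 2), (corner d 3).
have nd i : 1 < i -> i < (face_length F).-1 -> ~~ dominates a (corner d i).
  move=> i1 ik; have [k0 ik'] : 0 < face_length F /\ i < face_length F by clear -F5 ik; lia.
  rewrite ad; apply/negP => /(@dominates_corners F d 0 i iF dF k0 ik').
  by clear -i1 ik; lia.
have [n2 n3] : ~~ dominates a (corner d 2) /\ ~~ dominates a (corner d 3).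
  by split; apply: nd; clear -F5; lia.
have VV i : corner d i \in V by apply: corner_face_vertices.
split => //.
- by have := dom _ (VV 2); rewrite (negPf n2).
- by have := dom _ (VV 3); rewrite (negPf n3).
split => //; last exact: (edge_corner iF).
by apply: (corner_neq iF dF); clear -F5; lia.
Qed.

End Robber.

(** * Two long internal faces cannot both be dominated *)

Section TwoFaces.
Variables F1 F2 : {set T * T}.
Hypotheses (iF1 : F1 \in internal_faces P) (iF2 : F2 \in internal_faces P).
Hypotheses (F1_5 : 4 < face_length F1) (F2_5 : 4 < face_length F2).
Hypothesis F12 : F1 != F2.
Let V1 := face_vertices F1.
Let V2 := face_vertices F2.

Lemma shared_dominates a b : a \in V1 -> a \in V2 -> b \in V1 -> b \in V2 -> dominates a b.
Proof.
move=> a1 a2 b1 b2; have [->|ab] := eqVneq a b; first by rewrite /dominates eqxx.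
exact: face_dominates iF1 (two_faces_share iF1 iF2 F12 a1 a2 b1 b2 ab).
Qed.

Lemma neighbours_in_face (F : {set T * T}) a : F \in internal_faces P ->
  4 < face_length F -> a \in face_vertices F ->
  exists y y' z z', [/\ [/\ y \in face_vertices F, y' \in face_vertices F,
      z \in face_vertices F & z' \in face_vertices F],
    [/\ e a y, e y y', e a z & e z z'] &
    [/\ ~~ dominates a y', ~~ dominates a z' & ~~ dominates y z]].
Proof.
move=> iF F5 /imsetP[d dF ad].
exists (corner d 1), (corner d 2), (corner d (face_length F).-1),
  (corner d (face_length F).-2).
have kE : face_length F = (face_length F).-1.+1 by clear -F5; lia.
have kE' : (face_length F).-1 = (face_length F).-2.+1 by clear -F5; lia.
have nd i j : i < face_length F -> j < face_length F -> 1 < j - i -> (i == 0) ==>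
  (j != (face_length F).-1) ->
    ~~ dominates (corner d i) (corner d j).
  move=> ik jk ij c; apply/negP => /(dominates_corners iF dF ik jk).
  by clear -ij c; lia.
split; first by rewrite !corner_face_vertices.
  split; rewrite ?ad.
  - exact: (edge_corner iF 0).
  - exact: (edge_corner iF).
  - by rewrite -(corner_period iF dF) e_sym {2}kE; apply: (edge_corner iF).
  by rewrite e_sym {2}kE'; apply: (edge_corner iF).
rewrite ad; split; [apply: (nd 0)|apply: (nd 0)|apply: nd]; clear -F5; lia.
Qed.

(** On [F1] the component of [b] is attached to two vertices far from [a]; it is also attached to
    [a], which makes three. Indeed the two neighbours of [a] on [F2] are not adjacent, so one is off
    [F1], and the vertex of [F2] beyond it must be dominated by [b]. *)
Lemma shared_cop a b : a \in V1 -> a \in V2 -> b \notin V1 ->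
  face_dominated F1 a b -> face_dominated F2 a b -> False.
Proof.
move=> a1 a2 b1 D1 D2.
have [x [y [x1 y1 bx by_ [nax nay xy _]]]] := face_dominated_opposite iF1 F1_5 D1 a1.
have ax : attached F1 b x by apply: adjacent_attached.
have ay : attached F1 b y by apply: adjacent_attached.
suff aa : attached F1 b a.
  apply: (face_tripod iF1 b1 aa ax ay) => //.
    by apply: contraNneq nax => ->; rewrite /dominates eqxx.
  by apply: contraNneq nay => ->; rewrite /dominates eqxx.
have side u u' : u' \in V2 -> e a u -> e u u' -> ~~ dominates a u' -> u \notin V1 ->
    attached F1 b a.
  move=> u'2 au uu' nau' u1.
  have u'1 : u' \notin V1 by apply: contra nau' => u'1; apply: shared_dominates.
  have bu' : dominates b u' by have := D2 _ u'2; rewrite (negPf nau').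
  have cbu : connect (avoid e V1) b u.
    apply: connect_trans (connect_avoid1 b1 u'1 bu') _.
    by apply: connect_avoid1 => //; rewrite dominates_sym /dominates uu' orbT.
  by apply: attached_connect cbu _; apply: adjacent_attached;
    rewrite // dominates_sym /dominates au orbT.
have [u [u' [w [w' [[u2 u'2 w2 w'2] [au uu' aw ww'] [nu' nw' nuw]]]]]] :=
  neighbours_in_face iF2 F2_5 a2.
have [u1|u1] := boolP (u \in V1); last exact: side u'2 au uu' nu' u1.
apply: side w'2 aw ww' nw' _; apply: contra nuw => w1.
exact: shared_dominates.
Qed.

(** All attachments on [F1] of the component of [b] are out of reach of [a]. A neighbour of [b] on
    [F2] off [F1] would yield one within reach, because the next vertex of [F2] is dominated by [a].
    So both neighbours lie on [F1] and would be adjacent. *)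
Lemma separate_cops a b : a \in V1 -> a \notin V2 -> b \in V2 -> b \notin V1 ->
  face_dominated F1 a b -> face_dominated F2 a b -> False.
Proof.
move=> a1 a2 b2 b1 D1 D2.
have [x [y [x1 y1 bx by_ [nax nay nxy exy]]]] := face_dominated_opposite iF1 F1_5 D1 a1.
have ax : attached F1 b x by apply: adjacent_attached.
have ay : attached F1 b y by apply: adjacent_attached.
have third z : attached F1 b z -> z = x \/ z = y.
  move=> az; have [->|zx] := eqVneq z x; first by left.
  have [->|zy] := eqVneq z y; first by right.
  by case: (face_tripod iF1 b1 ax ay az nxy); rewrite eq_sym.
have far z : attached F1 b z -> ~~ dominates a z by case/third => ->.
have side u u' : u' \in V2 -> e b u -> e u u' -> ~~ dominates b u' -> u \in V1.
  move=> u'2 bu uu' nbu'; apply/negPn/negP => u1.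
  have au' : dominates a u' by have := D2 _ u'2; rewrite (negPf nbu') orbF.
  have cbu : connect (avoid e V1) b u by apply: connect_avoid1;
    rewrite // /dominates bu orbT.
  have [u'1|u'1] := boolP (u' \in V1).
    have /far : attached F1 b u'.
      by apply: attached_connect cbu _; apply: adjacent_attached;
        rewrite // /dominates uu' orbT.
    by rewrite au'.
  have /far : attached F1 b a.
    apply: (attached_connect (c' := u')); last by apply: adjacent_attached;
      rewrite // dominates_sym.
    by apply: connect_trans cbu _; apply: connect_avoid1; rewrite // /dominates uu' orbT.
  by rewrite /dominates eqxx.
have [u [u' [w [w' [[u2 u'2 w2 w'2] [bu uu' bw ww'] [nu' nw' nuw]]]]]] :=
  neighbours_in_face iF2 F2_5 b2.
case/negP: nuw; apply: shared_dominates => //; [exact: side bu uu' nu'|exact: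
  side bw ww' nw'].
Qed.

(** Two shared vertices are equal or adjacent, and such a pair cannot dominate a face of length at
    least 5. *)
Lemma shared_cops a b : a \in V1 -> a \in V2 -> b \in V1 -> b \in V2 ->
  face_dominated F1 a b -> False.
Proof.
move=> a1 a2 b1 b2 D1; have ab := shared_dominates a1 a2 b1 b2.
have /imsetP[d dF ad] := a1; have [i ik bi] := face_verticesP iF1 dF b1.
have k0 : 0 < face_length F1 by clear -F1_5; lia.
move: ab; rewrite ad bi => /(@dominates_corners _ _ 0 i iF1 dF k0 ik) ai.
have dom j : 1 < j -> j < (face_length F1).-1 -> dominates (corner d i) (corner d j).
  move=> j1 jk; have jk' : j < face_length F1 by clear -jk; lia.
  have := D1 _ (corner_face_vertices iF1 j dF); rewrite ad bi => /orP[|//].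
  by move/(@dominates_corners _ _ 0 j iF1 dF k0 jk'); clear -j1 jk; lia.
have [k2 k3] : 2 < face_length F1 /\ 3 < face_length F1 by clear -F1_5; lia.
have /(dominates_corners iF1 dF ik k2) : dominates (corner d i) (corner d 2).
  by apply: dom; clear -F1_5; lia.
have /(dominates_corners iF1 dF ik k3) : dominates (corner d i) (corner d 3).
  by apply: dom; clear -F1_5; lia.
by clear -ai F1_5; lia.
Qed.

End TwoFaces.

Lemma face_dominatedC (F : {set T * T}) a b : face_dominated F a b -> face_dominated F b a.
Proof. by move=> D x /D; rewrite orbC. Qed.

Lemma two_faces_not_dominated (F1 F2 : {set T * T}) a b :
  F1 \in internal_faces P -> F2 \in internal_faces P ->
  4 < face_length F1 -> 4 < face_length F2 -> F1 != F2 ->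
  face_dominated F1 a b -> face_dominated F2 a b -> False.
Proof.
move=> i1 i2 k1 k2 n12 D1 D2; have n21 : F2 != F1 by rewrite eq_sym.
have shared c c' : c \in face_vertices F1 -> c \in face_vertices F2 ->
    face_dominated F1 c c' -> face_dominated F2 c c' -> False.
  move=> c1 c2 E1 E2; have [c'1|c'1] := boolP (c' \in face_vertices F1); last first.
    exact: shared_cop i1 i2 k1 k2 n12 _ _ c1 c2 c'1 E1 E2.
  have [c'2|c'2] := boolP (c' \in face_vertices F2).
    exact: shared_cops i1 i2 k1 n12 _ _ c1 c2 c'1 c'2 E1.
  exact: shared_cop i2 i1 k2 k1 n21 _ _ c2 c1 c'2 E2 E1.
wlog a1 : a b D1 D2 / a \in face_vertices F1.
  move=> W; case: (face_dominated_mem i1 k1 D1) => h; first exact: W D1 D2 h.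
  exact: W (face_dominatedC D1) (face_dominatedC D2) h.
have [a2|a2] := boolP (a \in face_vertices F2); first exact: shared D1 D2.
have b2 : b \in face_vertices F2.
  by case: (face_dominated_mem i2 k2 D2) => // h; rewrite h in a2.
have [b1|b1] := boolP (b \in face_vertices F1).
  exact: shared (face_dominatedC D1) (face_dominatedC D2).
exact: separate_cops i1 i2 k1 k2 n12 _ _ a1 a2 b2 b1 D1 D2.
Qed.

Lemma two_cops_face_condition : cops_win e 2 ->
  #|[set F in internal_faces P | (#|F| == 5) || (#|F| == 6)]| <= 1 /\
  forall F, F \in internal_faces P -> #|F| <= 6.
Proof.
case=> -[|a [|b [|? ?]]] // _ win.
have dom F : F \in internal_faces P -> 4 < face_length F -> face_dominated F a b.
  move=> iF F5 x xV; apply/negPn/negP => nd.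
  by apply: (robber_wins_undominated iF F5) win => /(_ x xV); apply/negP.
split=> [|F iF]; rewrite leqNgt; apply/negP.
  case/card_gt1P => F1 [F2 [/setIdP[i1 k1] /setIdP[i2 k2] n12]].
  have {}k1 : 4 < face_length F1 by case/orP: k1 => /eqP; rewrite /face_length => ->.
  have {}k2 : 4 < face_length F2 by case/orP: k2 => /eqP; rewrite /face_length => ->.
  exact: two_faces_not_dominated i1 i2 k1 k2 n12 (dom _ i1 k1) (dom _ i2 k2).
rewrite -/(face_length F) => k6.
have k5 : 4 < face_length F by clear -k6; lia.
have := face_dominated_card iF (dom _ iF k5).
have := card_dominated_le3 iF k5 a; have := card_dominated_le3 iF k5 b.
by move: #|_| #|_| k6 => x y; clear; lia.
Qed.

(** * The cops' strategy *)

Lemma capture a b r : dominates a r || dominates b r -> cops_force e [:: a; b] r.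
Proof.
move=> ar; case/orP: ar => h.
  apply: (cf_capture (cs' := [:: r; b])); last exact: mem_head.
  by rewrite /cop_step /= -/(dominates a r) h eqxx.
apply: (cf_capture (cs' := [:: a; r])); last by rewrite !inE eqxx orbT.
by rewrite /cop_step /= -/(dominates b r) h eqxx.
Qed.

Lemma capture1 a r : dominates a r -> cops_force e [:: a] r.
Proof.
move=> h; apply: (cf_capture (cs' := [:: r])); last exact: mem_head.
by rewrite /cop_step /= -/(dominates a r) h.
Qed.

(** The implication with conclusion [dominates a' b'] is the protection: when the robber attacks one
    cop, the other captures him. *)
Lemma cops_move a b a' b' r : dominates a a' -> dominates b b' -> r != a' -> r != b' ->
  (dominates r a' || dominates r b' -> dominates a' b') ->
  (forall r', dominates r r' -> r' != a' -> r' != b' -> cops_force e [:: a'; b'] r') ->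
  cops_force e [:: a; b] r.
Proof.
move=> aa' bb' ra' rb' att win.
apply: (cf_continue (cs' := [:: a'; b'])).
- by rewrite /cop_step /= -/(dominates a a') -/(dominates b b') aa' bb'.
- by rewrite !inE negb_or ra' rb'.
move=> r'; rewrite eq_sym -/(dominates r r') => rr'; case: ifP; last first.
  by rewrite !inE => /negbT; rewrite negb_or => /andP[? ?]; apply: win.
rewrite !inE /= [a' == r']eq_sym; have [r'a' _|r'a' /= /eqP r'b'] := eqVneq r' a'.
  by subst r'; apply: capture1; rewrite dominates_sym; apply: att; rewrite rr'.
by subst r'; rewrite eqxx; apply: capture1; apply: att; rewrite rr' orbT.
Qed.

Lemma cops_force_swap cs r : cops_force e cs r ->
  forall a b, cs = [:: a; b] -> cops_force e [:: b; a] r.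
Proof.
elim=> {cs r} [cs r cs' st rcs|cs r cs' st rcs h IH] a b ?; subst cs;
  have [a' [b' [? aa' bb']]] := cop_step2 st; subst cs'.
  by apply: capture; move: rcs; rewrite !inE => /orP[] /eqP ->; rewrite ?aa' ?bb' ?orbT.
apply: (cf_continue (cs' := [:: b'; a'])).
- by rewrite /cop_step /= -/(dominates a a') -/(dominates b b') aa' bb'.
- by move: rcs; rewrite !inE orbC.
move=> r' rr'; move: (h _ rr') (IH _ rr'); rewrite !inE orbC /=.
case: ifP => [h1 + _|_ _]; last by apply.
by move: h1; rewrite [a' == r']eq_sym [b' == r']eq_sym;
  case: eqP => [->|]; case: eqP => [->|].
Qed.

Lemma cops_swap a b r : cops_force e [:: a; b] r -> cops_force e [:: b; a] r.
Proof. by move/cops_force_swap; apply. Qed.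

(** * Territories of the robber and guarded exits *)

Definition territory (S : {set T}) (r : T) : {set T} :=
  [set x | connect (avoid e S) r x].

Lemma territory_closed (S A : {set T}) r : r \in A ->
  (forall t t', t \in A -> e t t' -> t' \notin S -> t' \in A) ->
  territory S r \subset A.
Proof.
move=> rA cl; apply/subsetP => x; rewrite inE => /connectP[p pP ->].
elim: p r rA pP => //= y p IH r rA /andP[/and3P[ry _ yS]].
exact/IH/(cl r).
Qed.

Lemma territory_step (S : {set T}) r t t' : r \notin S -> t \in territory S r ->
  dominates t t' -> t' \notin S -> t' \in territory S r.
Proof.
rewrite !inE => rS rt tt' t'S; apply: connect_trans (rt) _.
exact: connect_avoid1 (connect_avoid_notin rS rt) t'S tt'.
Qed.

Lemma territory_refl (S : {set T}) r : r \in territory S r.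
Proof. by rewrite inE connect0. Qed.

Lemma territory_notin (S : {set T}) r t : r \notin S -> t \in territory S r -> t \notin S.
Proof. by rewrite inE => rS; apply: connect_avoid_notin. Qed.

Lemma territory_eq (S : {set T}) r t : t \in territory S r -> territory S t = territory S r.
Proof.
rewrite inE => rt; apply/setP => x; rewrite !inE.
by rewrite -(same_connect (avoid_connect_sym S e_sym) rt).
Qed.

Lemma territory_border (S : {set T}) r x : r \notin S -> x \in S ->
  exists t x', [/\ t \in territory S r, x' \in S & e t x'].
Proof.
move=> rS xS; have /connectP[p pP px] := G_conn r x; rewrite px in xS.
have {px x} : last r p \in S by [].
elim: p r rS pP {xS} => [|y p IH] r rS /=; first by rewrite (negPf rS).
case/andP => ry yP lS; have [yS|yS] := boolP (y \in S).
  by exists r, y; rewrite territory_refl.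
have [t [x' [ty x'S tx']]] := IH _ yS yP lS; exists t, x'; split => //.
rewrite -(territory_eq (t := y)) //.
by apply: (territory_step rS (territory_refl S r)); rewrite // /dominates ry orbT.
Qed.

Definition guarded (S : {set T}) (r y z : T) :=
  forall t x, t \in territory S r -> x \in S -> e t x -> x = y \/ x = z.

Lemma guardedC (S : {set T}) r y z : guarded S r y z -> guarded S r z y.
Proof. by move=> g t x tK xS tx; case: (g t x tK xS tx); [right|left]. Qed.

Lemma guarded_step (S : {set T}) r y z t t' : r \notin S -> guarded S r y z ->
  t \in territory S r -> dominates t t' -> t' != y -> t' != z -> t' \in territory S r.
Proof.
move=> rS g tK tt' t'y t'z; apply: (territory_step rS tK tt'); apply/negP => t'S.
case/orP: tt' => [/eqP tt'|tt'].
  by have := territory_notin rS tK; rewrite tt' t'S.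
by case: (g _ _ tK t'S tt') => E; rewrite E eqxx in t'y t'z.
Qed.

Lemma guarded_territory (S : {set T}) r r' y z : r \notin S -> guarded S r y z ->
  r' \in territory S r -> territory [set y; z] r' \subset territory S r.
Proof.
move=> rS g r'K; apply: territory_closed => // t t' tK tt'.
rewrite !inE negb_or => /andP[t'y t'z].
by have := guarded_step rS g tK _ t'y t'z; rewrite inE /dominates tt' orbT; apply.
Qed.

Lemma move_both (S : {set T}) a b y z r : r \notin S -> y \in S -> z \in S ->
  dominates a y -> dominates b z -> dominates y z -> guarded S r y z ->
  (forall r', r' \in territory S r -> cops_force e [:: y; z] r') ->
  cops_force e [:: a; b] r.
Proof.
move=> rS yS zS ay bz yz g win; apply: (cops_move ay bz) => //.
- by apply: contraNneq rS => ->.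
- by apply: contraNneq rS => ->.
move=> r' rr' r'y r'z; apply: win.
exact: guarded_step rS g (territory_refl S r) rr' r'y r'z.
Qed.

(** While one cop holds [b], the other passes through [c'], which the robber cannot attack since his
    component touches [S] only at [b] and [z]. If he steps onto [z] meanwhile, he is captured from
    [c']. *)
Lemma move_two_steps (S : {set T}) c c' z b r : r \notin S ->
  c' \in S -> z \in S -> b \in S -> e c c' -> e c' z -> dominates z b ->
  c' != z -> c' != b -> guarded S r b z ->
  (forall r', r' \in territory S r -> cops_force e [:: z; b] r') ->
  cops_force e [:: c; b] r.
Proof.
move=> rS c'S zS bS cc' c'z zb nc'z nc'b g win.
have [|] := boolP (dominates c r || dominates b r); first exact: capture.
rewrite negb_or => /andP[_ nbr].
apply: (cops_move (a' := c') (b' := b)).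
- by rewrite /dominates cc' orbT.
- by rewrite /dominates eqxx.
- by apply: contraNneq rS => ->.
- by apply: contraNneq rS => ->.
- rewrite [dominates r b]dominates_sym (negPf nbr) orbF => /orP[/eqP rc'|rc'].
    by rewrite rc' c'S in rS.
  by case: (g _ _ (territory_refl S r) c'S rc') => E; rewrite E eqxx in nc'z nc'b.
move=> r' rr' r'c' r'b; have [r'z|r'z] := eqVneq r' z.
  by apply: capture; rewrite r'z /dominates c'z orbT.
have r'K := guarded_step rS g (territory_refl S r) rr' r'b r'z.
have KE := territory_eq r'K.
apply: (@move_both S _ _ z b r' (territory_notin rS r'K) zS bS _ _ zb).
- by rewrite /dominates c'z orbT.
- by rewrite /dominates eqxx.
- by move=> t x; rewrite KE => tK xS tx; case: (g t x tK xS tx); [right|left].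
by rewrite KE.
Qed.

Definition small_faces (K : {set T}) := forall F x, F \in internal_faces P ->
  x \in face_vertices F -> x \in K -> face_length F <= 4.

Lemma attached_guarded (F : {set T * T}) r : F \in internal_faces P ->
  r \notin face_vertices F ->
  exists2 d, d \in F & guarded (face_vertices F) r d.1 d.2.
Proof.
move=> iF rF; have [y [z [yz h]]] := attached_edge iF rF; exists (y, z) => //=.
by move=> t x; rewrite inE => rt xF tx; apply: h; split => //; exists t.
Qed.

(* The cops guard a vertex or an edge [uv], the robber being confined to a
   component of its complement; crossing a face of length at most four they
   reach another edge which cuts off a smaller territory. *)
Lemma guard_wins n u v r : dominates u v -> #|territory [set u; v] r| <= n ->
  small_faces (territory [set u; v] r) -> cops_force e [:: u; v] r.
Proof.
elim: n u v r => [|n IH] u v r uv.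
  rewrite leqn0 cards_eq0 => /eqP K0; have := territory_refl [set u; v] r.
  by rewrite K0 inE.
have next (K A : {set T}) y z r' w : #|K| <= n.+1 -> small_faces K -> A \subset K ->
    w \in K -> w \notin A -> dominates y z -> territory [set y; z] r' \subset A ->
    cops_force e [:: y; z] r'.
  move=> Kn Ks AK wK wA yz tA; apply: IH => //.
    rewrite -ltnS; apply: leq_trans Kn; apply: leq_ltn_trans (subset_leq_card tA) _.
    by apply: proper_card; apply/properP; split => //; exists w.
  by move=> F x iF xF /(subsetP tA)/(subsetP AK); apply: Ks.
(* With both cops on [a], one steps to a neighbour [t] in the territory, protected by the other; the
   territory loses [t]. *)
have same a r1 : #|territory [set a; a] r1| <= n.+1 ->
    small_faces (territory [set a; a] r1) -> cops_force e [:: a; a] r1.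
  set K := territory _ _ => Kn Ks.
  have [|] := boolP (dominates a r1 || dominates a r1); first exact: capture.
  rewrite orbb => nar.
  have rS : r1 \notin [set a; a].
    by rewrite !inE orbb; apply: contraNneq nar => ->; rewrite /dominates eqxx.
  have aS : a \in [set a; a] by rewrite !inE eqxx.
  have [t [a' [tK a'S ta]]] := territory_border rS aS.
  have {a' a'S}ta : e t a by move: a'S ta; rewrite !inE orbb => /eqP ->.
  have at_ : dominates a t by rewrite /dominates e_sym ta orbT.
  have rt : r1 != t by apply: contraNneq nar => ->.
  have ra : r1 != a by apply: contraNneq nar => ->; rewrite /dominates eqxx.
  have dd : dominates a a by rewrite /dominates eqxx.
  apply: (cops_move dd at_ ra rt) => // r' rr' r'a r't.
  have r'S : r' \notin [set a; a] by rewrite !inE orbb.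
  have r'K : r' \in K by apply: territory_step rr' r'S => //; apply: territory_refl.
  apply: (next K (K :\ t) a t r' t) => //; rewrite ?subsetDl // ?inE ?eqxx //.
  apply: territory_closed => [|x x']; rewrite !in_setD1 ?r't //.
  move=> /andP[_ xK] xx'; rewrite !inE negb_or => /andP[x'a x't]; rewrite x't /=.
  have : x' \in K; last by rewrite inE.
  by apply: (territory_step rS xK); rewrite /dominates ?xx' ?orbT // !inE orbb.
have [|] := boolP (dominates u r || dominates v r); first by move=> *; apply: capture.
rewrite negb_or => /andP[nur nvr] Kn Ks.
have [uvE|nuv] := eqVneq u v; first by subst v; apply: same.
have {}uv : e u v by case/orP: uv => // /eqP uv; rewrite uv eqxx in nuv.
wlog [F [iF uvF FK]] : u v nur nvr Kn Ks nuv uv / exists F, [/\ F \in internal_faces P,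
  (u, v) \in F &
    forall w, w \in face_vertices F -> w != u -> w != v -> w \in territory [set u; v] r].
  move=> W.
  have rS : r \notin [set u; v].
    rewrite !inE negb_or; apply/andP; split.
      by apply: contraNneq nur => ->; rewrite /dominates eqxx.
    by apply: contraNneq nvr => ->; rewrite /dominates eqxx.
  (* If no vertex of the territory touches [b], the cop there joins the other on [a] without
     enlarging the territory, and [same] makes the progress. *)
  have one a b : r \notin [set a; b] -> e a b -> ~~ dominates a r ->
      #|territory [set a; b] r| <= n.+1 -> small_faces (territory [set a; b] r) ->
      ~~ [exists t in territory [set a; b] r, e t b] -> cops_force e [:: a; b] r.
    set K := territory _ _ => rab ab nar Kn' Ks' nb.
    have nb' t : t \in K -> e t b -> False.
      by move=> tK tb; case/negP: nb; apply/existsP; exists t; rewrite tK.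
    have cl t t' : t \in K -> e t t' -> t' \notin [set a; a] -> t' \in K.
      move=> tK tt'; rewrite in_set2 orbb => t'a.
      apply: (territory_step rab tK); rewrite /dominates ?tt' ?orbT // !inE negb_or t'a /=.
      by apply: contraPneq (nb' _ tK) => <- /(_ tt').
    have dd : dominates a a by rewrite /dominates eqxx.
    have ba : dominates b a by rewrite /dominates e_sym ab orbT.
    have ra : r != a by apply: contraNneq nar => ->; rewrite /dominates eqxx.
    apply: (cops_move dd ba ra ra) => // r' rr' r'a _.
    have r'K : r' \in K.
      case/orP: rr' => [/eqP <-|rr']; first exact: territory_refl.
      by apply: (cl r) => //; [apply: territory_refl|rewrite !inE orbb].
    have sub := territory_closed r'K cl.
    apply: same; first exact: leq_trans (subset_leq_card sub) Kn'.
    by move=> F x iF xF /(subsetP sub); apply: Ks'.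
  have [/existsP[t2 /andP[t2K t2v]]|nv] := boolP [exists t in territory [set u; v] r,
    e t v]; last first.
    exact: one.
  have [/existsP[t1 /andP[t1K t1u]]|nu] := boolP [exists t in territory [set u; v] r,
    e t u]; last first.
    apply: cops_swap; rewrite setUC in rS Kn Ks nu; apply: one => //.
    by rewrite e_sym.
  have t1S := territory_notin rS t1K.
  have t12 : connect (avoid e [set u; v]) t1 t2.
    by move: t2K; rewrite -(territory_eq t1K) inE.
  have ut1 : e u t1 by rewrite e_sym.
  have [F [iF uvF FK]] := internal_face_at_edge uv t1S t12 ut1 t2v.
  have FK' w : w \in face_vertices F -> w != u -> w != v -> w \in territory [set u; v] r.
    by move=> wF wu wv; rewrite -(territory_eq t1K) inE; apply: FK.
  case: uvF => uvF; first by apply: W => //; exists F.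
  apply: cops_swap; apply: W => //; rewrite ?[[set v; u]]setUC //; first by rewrite eq_sym.
    by rewrite e_sym.
  by exists F; split => // w wF wv wu; apply: FK'.
set K := territory [set u; v] r in Kn Ks FK.
have rS : r \notin [set u; v].
  rewrite !inE negb_or; apply/andP; split.
    by apply: contraNneq nur => ->; rewrite /dominates eqxx.
  by apply: contraNneq nvr => ->; rewrite /dominates eqxx.
pose c := corner (u, v).
have c0 : c 0 = u by [].
have c1 : c 1 = v by rewrite /c /corner /= (face_perm_origin (face_dart (internal_face iF) uvF)).
have k3 : 2 < face_length F := internal_face_size_gt2 iF.
have ec i : e (c i) (c i.+1) by apply: (edge_corner iF).
have cV i : c i \in face_vertices F by apply: (corner_face_vertices iF).
have cne i j : i < face_length F -> j < face_length F -> i != j -> c i != c j.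
  exact: corner_neq.
have c2K : c 2 \in K.
  by apply: FK => //; rewrite -?c1 -?c0; apply: cne; clear -k3; lia.
have k4 : face_length F <= 4 := Ks F _ iF (cV 2) c2K.
(* Two consecutive corners dominate a cycle of length at most 4, and the robber is dominated by
   neither cop. *)
have rF : r \notin face_vertices F.
  apply/negP => /(face_verticesP iF uvF)[i ik].
  rewrite -/(c i) => ri; have : dominates u (c i) || dominates v (c i).
    have ck : c (face_length F) = c 0 by apply: (corner_period iF).
    have := ec 0; have := ec 1; have := ec 2; have := ec 3; move: ck ik k3 k4 ri;
      rewrite /dominates -c1 -c0.
    case: (face_length F) => [|[|[|[|[|k]]]]] // ck; case: i =>
      [|[|[|[|i]]]] // _ _ _ _ h3 h2 h1 h0;
      rewrite ?ck in h3 h2; by rewrite ?eqxx ?h0 ?h1 ?orbT // e_sym ?h2 ?h3 ?orbT.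
  by rewrite -ri (negPf nur) (negPf nvr).
have [d dF gd] := attached_guarded iF rF.
set S := face_vertices F in rF gd.
have c2S : c 2 \notin territory S r.
  by apply: contraL (cV 2); apply: territory_notin.
have subK : territory S r \subset K.
  apply: territory_closed => [|t t' tK tt' t'S]; first exact: territory_refl.
  apply: (territory_step rS tK); first by rewrite /dominates tt' orbT.
  by rewrite !inE; apply: contra t'S => /orP[] /eqP ->; rewrite -?c1 -?c0; apply: cV.
have fin y z r' : dominates y z -> guarded S r y z -> r' \in territory S r ->
  cops_force e [:: y; z] r'.
  move=> yz g r'K; apply: (next K (territory S r) y z r' (c 2)) => //.
  exact: guarded_territory.
(* Otherwise the territory cut off by [u] and [v] would lie in a component of G - F, yet it contains
   [c 2]. *)
have not_uv : guarded S r u v -> False.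
  move=> g; case/negP: c2S; apply: (subsetP (guarded_territory rF g (territory_refl S r))).
  by [].
have dom i : dominates (c i) (c i.+1) by rewrite /dominates ec orbT.
have dom' i : dominates (c i.+1) (c i) by rewrite dominates_sym.
have domr x : dominates x x by rewrite /dominates eqxx.
have ck : c (face_length F) = c 0 by apply: (corner_period iF).
have [i ik di] : exists2 i, i < face_length F & d = (c i, c i.+1).
  have [i ik _] := face_verticesP iF uvF (imset_f fst dF).
  exists (findex phi (u, v) d).
    by rewrite -(order_face iF uvF) findex_max // (face_connect (internal_face iF)).
  by rewrite -(iter_corner iF) // iter_findex // (face_connect (internal_face iF)).
rewrite di /= in gd; rewrite -c1 -c0 in not_uv *.
have cases : face_length F = 3 \/ face_length F = 4 by clear -k3 k4; lia.
case: cases => kE; rewrite kE in ik ck cne.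
- case: i ik di gd => [|[|[|//]]] _ _ gd; first by case: not_uv.
  + apply: (move_both rF (cV 2) (cV 1)) => //; [|exact: guardedC|].
      by rewrite dominates_sym -ck.
    by move=> r'; apply: fin => //; apply: guardedC.
  rewrite ck in gd; apply: (move_both rF (cV 0) (cV 2)) => //; [|exact: guardedC|].
    by rewrite dominates_sym -ck.
  by move=> r'; apply: fin; [rewrite dominates_sym -ck|apply: guardedC].
- case: i ik di gd => [|[|[|[|//]]]] _ _ gd; first by case: not_uv.
  + apply: (move_two_steps rF (cV 3) (cV 2) (cV 1)) => //.
    * by rewrite e_sym -ck.
    * by rewrite e_sym.
    * exact: cne.
    * exact: cne.
    by move=> r'; apply: fin => //; apply: guardedC.
  + apply: (move_both rF (cV 3) (cV 2)) => //; [|exact: guardedC|].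
      by rewrite dominates_sym -ck.
    by move=> r'; apply: fin => //; apply: guardedC.
  rewrite ck in gd; apply: cops_swap.
  apply: (move_two_steps rF (cV 2) (cV 3) (cV 0)) => //.
  * by rewrite -ck.
  * exact: cne.
  * exact: cne.
  * exact: guardedC.
  by move=> r'; apply: fin => //; rewrite -ck.
Qed.

Lemma face_condition_two_cops :
  #|[set F in internal_faces P | (#|F| == 5) || (#|F| == 6)]| <= 1 ->
  (forall F, F \in internal_faces P -> #|F| <= 6) -> cops_win e 2.
Proof.
move=> one max6.
have domr x : dominates x x by rewrite /dominates eqxx.
have [/existsP[F /andP[iF F5]]|none] :=
  boolP [exists F in internal_faces P, 4 < face_length F]; last first.
  (* Without a long face, any vertex holding both cops starts the chase. *)
  exists [:: (outer_dart P).1; (outer_dart P).1] => // r; apply: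
    guard_wins (leqnn _) _ => //.
  move=> F x iF _ _; rewrite leqNgt; apply: contra none => F5.
  by apply/existsP; exists F; rewrite iF.
have F6 : face_length F <= 6 := max6 F iF.
have big F' : F' \in internal_faces P -> 4 < face_length F' ->
    F' \in [set F in internal_faces P | (#|F| == 5) || (#|F| == 6)].
  move=> iF' F'5; apply/setIdP; split => //; have := max6 _ iF'.
  by rewrite -/(face_length F'); clear -F'5; lia.
have uniqF F' : F' \in internal_faces P -> 4 < face_length F' -> F' = F.
  by move=> iF' F'5; apply: (card_le1_eqP one); apply: big.
have [d dF] : exists d, d \in F.
  by apply/card_gt0P; rewrite -/(face_length F); clear -F5; lia.
pose c := corner d.
have ec i : e (c i) (c i.+1) by apply: (edge_corner iF).
have cV i : c i \in face_vertices F by apply: (corner_face_vertices iF).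
have cne i j : i < face_length F -> j < face_length F -> i != j -> c i != c j.
  exact: corner_neq.
have ck : c (face_length F) = c 0 by apply: (corner_period iF).
have dom i : dominates (c i) (c i.+1) by rewrite /dominates ec orbT.
have dom' i : dominates (c i.+1) (c i) by rewrite dominates_sym.
set S := face_vertices F.
(* Once the cops hold the exits, the territory avoids [F], the only long face, so every internal
   face meeting it is short. *)
have fin r y z r' : r \notin S -> dominates y z -> guarded S r y z ->
    r' \in territory S r -> cops_force e [:: y; z] r'.
  move=> rS yz g r'K; apply: guard_wins yz (leqnn _) _ => F' x iF' xF' xK.
  rewrite leqNgt; apply/negP => /(uniqF _ iF') F'F; subst F'.
  have := territory_notin rS (subsetP (guarded_territory rS g r'K) _ xK).
  by rewrite xF'.
have edge r : r \notin S -> exists2 i, i < face_length F & guarded S r (c i) (c i.+1).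
  move=> rS; have [d' d'F gd] := attached_guarded iF rS.
  exists (findex phi d d').
    by rewrite -(order_face iF dF) findex_max // (face_connect (internal_face iF)).
  have := iter_corner iF (findex phi d d') dF.
  by rewrite iter_findex ?(face_connect (internal_face iF)) // => dE; rewrite dE in gd.
have mem_c r : r \in S -> exists2 i, i < face_length F & r = c i.
  by move/(face_verticesP iF dF).
have cases : face_length F = 5 \/ face_length F = 6 by clear -F5 F6; lia.
case: cases => kE; rewrite kE in edge mem_c ck cne.
- have dom40 : dominates (c 4) (c 0) by rewrite -ck.
  have dom04 : dominates (c 0) (c 4) by rewrite dominates_sym.
  have e40 : e (c 4) (c 0) by rewrite -ck.
  have e04 : e (c 0) (c 4) by rewrite e_sym.
  exists [:: c 0; c 2] => // r.
  have [rS|rS] := boolP (r \in S).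
    have [i ik ->] := mem_c r rS; apply: capture.
    by case: i ik => [|[|[|[|[|//]]]]] _; rewrite ?domr ?dom ?dom' ?dom04 ?orbT.
  have [i ik g] := edge r rS; have gC := guardedC g.
  (* Three edges can be occupied in a single move. For the edges [c 2], [c 3] and [c 4], [c 0], one
     cop waits at an end while the other takes two steps. *)
  case: i ik g gC => [|[|[|[|[|//]]]]] _ g gC.
  + by apply: (move_both rS (cV 0) (cV 1)) => // r'; apply: fin.
  + by apply: (move_both rS (cV 1) (cV 2)) => // r'; apply: fin.
  + apply: (move_two_steps rS (cV 4) (cV 3) (cV 2)) => //; rewrite ?cne // 1?e_sym //.
    by move=> r'; apply: fin.
  + by apply: (move_both rS (cV 4) (cV 3)) => // r'; apply: fin.
  rewrite ck in g gC; apply: cops_swap.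
  apply: (move_two_steps rS (cV 3) (cV 4) (cV 0)) => //; rewrite ?cne //.
  by move=> r'; apply: fin.
have dom50 : dominates (c 5) (c 0) by rewrite -ck.
have dom05 : dominates (c 0) (c 5) by rewrite dominates_sym.
have e50 : e (c 5) (c 0) by rewrite -ck.
have e05 : e (c 0) (c 5) by rewrite e_sym.
(* On the hexagon each cop covers three consecutive corners, so the pair must be antipodal. *)
exists [:: c 0; c 3] => // r.
have [rS|rS] := boolP (r \in S).
  have [i ik ->] := mem_c r rS; apply: capture.
  by case: i ik => [|[|[|[|[|[|//]]]]]] _; rewrite ?domr ?dom ?dom' ?dom05 ?orbT.
have [i ik g] := edge r rS; have gC := guardedC g.
case: i ik g gC => [|[|[|[|[|[|//]]]]]] _ g gC.
+ apply: cops_swap; apply: (move_two_steps rS (cV 2) (cV 1) (cV 0)) => //;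
  rewrite ?cne // 1?e_sym //.
  by move=> r'; apply: fin.
+ by apply: (move_both rS (cV 1) (cV 2)) => // r'; apply: fin.
+ apply: (move_two_steps rS (cV 1) (cV 2) (cV 3)) => //; rewrite ?cne //.
  by move=> r'; apply: fin.
+ apply: (move_two_steps rS (cV 5) (cV 4) (cV 3)) => //; rewrite ?cne // 1?e_sym //.
  by move=> r'; apply: fin.
+ by apply: (move_both rS (cV 5) (cV 4)) => // r'; apply: fin.
rewrite ck in g gC; apply: cops_swap.
apply: (move_two_steps rS (cV 4) (cV 5) (cV 0)) => //; rewrite ?cne //.
by move=> r'; apply: fin.
Qed.

(** The robber starts at a vertex that the lone cop does not dominate, then [one_cop_loses]
    applies. *)
Lemma no_universal_one_cop k : (forall v : T, ~ universal_vertex e v) ->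
  k < 2 -> ~ cops_win e k.
Proof.
move=> no_univ k2 [[|c [|? ?]] /= sz win]; rewrite -sz // in k2.
  by apply: no_cops_lose (win (outer_dart P).1) _.
apply: (no_univ c) => u uc; apply/negPn/negP => cu.
apply: one_cop_loses (win u) _ erefl _.
by rewrite /dominates eq_sym (negPf uc).
Qed.

End Embedding.

Theorem theorem4 (T : finType) (e : rel T)
  (e_sym : symmetric e) (e_irr : irreflexive e)
  (G_conn : graph_connected e)
  (no_univ : forall v : T, ~ universal_vertex e v)
  (P : outerplanar_embedding e) :
  attacking_cop_number_is e 2 <->
  (#|[set F in internal_faces P | (#|F| == 5) || (#|F| == 6)]| <= 1 /\
   forall F, F \in internal_faces P -> #|F| <= 6).
Proof.
split=> [[win _]|[one max6]]; first exact: two_cops_face_condition win.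
split=> [|k k2]; first exact: face_condition_two_cops one max6.
exact: no_universal_one_cop.
Qed.
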